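(* For a simplicial set $K$, the projection $\|K\|\to|K|$ from the thick to the standard geometric realisation is a homotopy equivalence.
   Context: Let $\boldsymbol{\Delta}$ be the simplicial operator category (so a simplicial set is a functor $\boldsymbol{\Delta}^{op}\to\mathsf{Sets}$), let $\boldsymbol{\Upsilon}\subseteq\boldsymbol{\Delta}$ be the subcategory generated by the injective maps (those corresponding to simplicial face operators), and let $\Delta^n$ be the geometric $n$-simplex. The thick realisation is the coend $\|K\|=\int^{\boldsymbol{\Upsilon},n}K_n\times\Delta^n$, in which identifications are made only along faces; the standard realisation is the coend $|K|=\int^{\boldsymbol{\Delta},n}K_n\times\Delta^n$, in which degenerate simplices are also factored out. The projection $\|K\|\to|K|$ is the canonical quotient map. *)

(* Defs.v *)
From HB Require Import structures.
From mathcomp Require Import all_boot all_order all_algebra.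
From mathcomp Require Import all_classical all_reals all_analysis.
From Stdlib Require Import Relation_Operators.

Set Implicit Arguments.
Unset Strict Implicit.
Unset Printing Implicit Defensive.

Import Order.TTheory GRing.Theory Num.Theory.
Import numFieldNormedType.Exports.

Local Open Scope classical_set_scope.
Local Open Scope ring_scope.
Local Open Scope quotient_scope.

(* The object [n] = {0 < ... < n} of Delta is the natural number n, with
   elements 'I_n.+1. *)
Record delta_hom (m n : nat) := DeltaHom {
  delta_fun :> 'I_m.+1 -> 'I_n.+1;
  delta_homo : {homo delta_fun : i j / (i <= j)%N}
}.

Definition delta_id n : delta_hom n n := @DeltaHom n n id (fun _ _ ij => ij).

Definition delta_comp l m n (g : delta_hom m n) (f : delta_hom l m) :
    delta_hom l n :=
  @DeltaHom l n (g \o f) (fun _ _ ij => delta_homo g (delta_homo f ij)).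

Record simplicial_set := SimplicialSet {
  cells :> nat -> Type;
  cell_map : forall m n, delta_hom m n -> cells n -> cells m;
  cell_map_id : forall n (x : cells n), cell_map (delta_id n) x = x;
  cell_map_comp : forall l m n (g : delta_hom m n) (f : delta_hom l m)
    (x : cells n), cell_map (delta_comp g f) x = cell_map f (cell_map g x)
}.

Definition simplex (R : realType) (n : nat) : set 'rV[R]_n.+1 :=
  [set t | (forall i, 0 <= t ord0 i) /\ \sum_i t ord0 i = 1].
Arguments simplex : clear implicits.

Section simplex.
Variable R : realType.

(* The affine extension of f on vertices, in barycentric coordinates. *)
Definition push_row m n (f : delta_hom m n) (t : 'rV[R]_m.+1) :
  'rV[R]_n.+1 := \row_j \sum_(i | f i == j) t ord0 i.

Lemma push_row_simplex m n (f : delta_hom m n) (t : 'rV[R]_m.+1) :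
  simplex R m t -> simplex R n (push_row f t).
Proof.
move=> [t0 t1]; split=> [j|]; first by rewrite mxE sumr_ge0.
rewrite -t1 (partition_big f xpredT)//=.
by apply: eq_bigr => j _; rewrite mxE.
Qed.

Definition simplex_map m n (f : delta_hom m n) (t : simplex R m) : simplex R n :=
  SigSub (mem_set (push_row_simplex f (set_mem (valP t)))).

End simplex.

Section realisation.
Variables (R : realType) (K : simplicial_set).

(* The coproduct over n of K_n x Delta^n, with K_n discrete. *)
Definition cell_points : topologicalType :=
  {n : nat & (discrete_topology {classic K n} * simplex R n)%type}.

Definition cell_point n (x : K n) (t : simplex R n) : cell_points :=
  existT _ n (x : discrete_topology {classic K n}, t).

(* A wide subcategory of Delta is given by the predicate selecting its
   morphisms. *)
Variable S : forall m n, delta_hom m n -> Prop.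

Variant coend_glue : cell_points -> cell_points -> Prop :=
  CoendGlue m n (f : delta_hom m n) (x : K n) (t : simplex R m) of S f :
    coend_glue (cell_point (cell_map f x) t) (cell_point x (simplex_map f t)).

Let coend_rel' (p q : cell_points) : bool :=
  `[< clos_refl_sym_trans cell_points coend_glue p q >].

Let coend_rel_refl : reflexive coend_rel'.
Proof. by move=> p; apply/asboolP/rst_refl. Qed.

Let coend_rel_sym : symmetric coend_rel'.
Proof. by move=> p q; apply/asboolP/asboolP; apply: rst_sym. Qed.

Let coend_rel_trans : transitive coend_rel'.
Proof.
by move=> q p r /asboolP pq /asboolP qr; apply/asboolP/(rst_trans _ _ _ _ _ pq).
Qed.

Definition coend_rel : equiv_rel cell_points :=
  EquivRel coend_rel' coend_rel_refl coend_rel_sym coend_rel_trans.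

Definition coend := quotient_topology {eq_quot coend_rel}.
HB.instance Definition _ := Topological.on coend.
HB.instance Definition _ := Quotient.on coend.

Lemma coend_eqP (p q : cell_points) :
  \pi_coend p = \pi_coend q <->
  clos_refl_sym_trans cell_points coend_glue p q.
Proof.
split=> [pq|pq]; last by apply/eqmodP/asboolP.
by have /eqmodP/asboolP : p = q %[mod {eq_quot coend_rel}] := pq.
Qed.

End realisation.

Definition in_Delta m n (f : delta_hom m n) : Prop := True.
Definition in_Upsilon m n (f : delta_hom m n) : Prop := injective f.

Definition thick_realisation (R : realType) (K : simplicial_set) :
  topologicalType := coend R K in_Upsilon.

Definition realisation (R : realType) (K : simplicial_set) :
  topologicalType := coend R K in_Delta.

Section projection.
Variables (R : realType) (K : simplicial_set).

Definition thick_class (p : cell_points R K) : thick_realisation R K :=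
  \pi_(coend R K in_Upsilon) p.

Definition thin_class (p : cell_points R K) : realisation R K :=
  \pi_(coend R K in_Delta) p.

(* By thick_projE, independent of the representative. *)
Definition thick_proj (z : thick_realisation R K) : realisation R K :=
  thin_class (repr (z : coend R K in_Upsilon)).

Lemma thick_projE (p : cell_points R K) :
  thick_proj (thick_class p) = thin_class p.
Proof.
have /coend_eqP pq : repr (\pi_(coend R K in_Upsilon) p) = p
    %[mod coend R K in_Upsilon] by exact: reprK.
apply/coend_eqP; move: (repr _) pq => q.
elim=> {p q} [_ _ [m n f x t _]|p|p q _|p q r _ pq _].
- by apply: rst_step; constructor.
- exact: rst_refl.
- exact: rst_sym.
- exact: rst_trans pq.
Qed.

End projection.

Definition unit_interval (R : realType) : set R := `[0, 1].
Arguments unit_interval : clear implicits.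

Section homotopy.
Variable R : realType.

Definition homotopic (X Y : topologicalType) (f g : X -> Y) : Prop :=
  exists H : X * unit_interval R -> Y,
    [/\ continuous H,
        forall x (s : unit_interval R), \val s = 0 -> H (x, s) = f x &
        forall x (s : unit_interval R), \val s = 1 -> H (x, s) = g x].

Definition homotopy_equivalence (X Y : topologicalType) (f : X -> Y) : Prop :=
  continuous f /\
  exists g : Y -> X,
    [/\ continuous g, homotopic (g \o f) id & homotopic (f \o g) id].

End homotopy.

(* Main.v *)
Require Import Defs.
From mathcomp Require Import all_boot all_order all_algebra.
From mathcomp Require Import all_classical all_reals all_analysis.
From mathcomp Require Import lra.
From Stdlib Require Import Relation_Operators.

(** A point t of the n-simplex is a partition of [0, 1] into n + 1 blocks, given by its cuts.
  In these terms a point of ||K|| is a point xi of |K| together with a finite set C of cuts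
  containing those of the normal form of xi, and the projection forgets C. Taking unions of C
  with rescaled finite sets gives canonical homotopies, so that it is enough to find a
  homotopy inverse xi |-> s(xi) whose base point is obtained from xi by a reparametrisation
  h_xi of [0, 1] (which can be deformed linearly to the identity).

  There is no natural choice of s. It is defined by recursion on the dimension of the normal
  form (z, t) of xi. Near the boundary of z, one projects radially to the boundary; the
  boundary point may have a normal form with fewer cuts, so the missing cuts are first
  grown out of 0 in a collar, and then the superfluous cuts of the boundary value are shrunk
  into 0. Deep inside z, one takes s(xi) to be the point t of the cell z and h_xi = id.

  Continuity into ||K|| holds because all these maps are, on finitely many closed pieces,
  given by a fixed cell and continuous coordinates; homotopies on a coend are continuous
  because the interval is locally compact. *)

Set Implicit Arguments.
Unset Strict Implicit.
Unset Printing Implicit Defensive.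

Import Order.TTheory GRing.Theory Num.Theory.
Import numFieldNormedType.Exports.

Local Open Scope classical_set_scope.
Local Open Scope ring_scope.
Local Open Scope quotient_scope.

(** * The simplex category *)

Lemma delta_hom_eq m n (f g : delta_hom m n) : f =1 g -> f = g.
Proof.
case: f g => [f f_homo] [g g_homo] /= /funext fg; move: f_homo; rewrite fg.
by move=> f_homo; congr DeltaHom; exact: Prop_irrelevance.
Qed.

Lemma delta_inj_lt m n (f : delta_hom m n) : injective f ->
  forall i j, (f i < f j)%N = (i < j)%N.
Proof.
move=> f_inj i j; case: (ltngtP i j) => [ij|ji|/ord_inj ->]; last by rewrite ltnn.
- rewrite ltn_neqAle delta_homo ?andbT; last exact: ltnW.
  by apply/eqP => /ord_inj/f_inj ij'; rewrite ij' ltnn in ij.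
- by apply/negbTE; rewrite -leqNgt delta_homo// ltnW.
Qed.

Lemma delta_inj_id n (f : delta_hom n n) : injective f -> f = delta_id n.
Proof.
move=> f_inj; apply: delta_hom_eq => i /=; apply/val_inj => /=.
have ge (j : 'I_n.+1) : (j <= f j)%N.
  case: j; elim=> [//|j IHj] jn /=.
  by apply: leq_ltn_trans (IHj (ltnW jn)) _; rewrite delta_inj_lt /=.
(* [k] is the distance of [j] from the top, so this induction descends from [n]. *)
have le k (j : 'I_n.+1) : (n - j = k)%N -> (f j <= j)%N.
  elim: k j => [|k IHk] j jk.
    by have := ltn_ord (f j); rewrite ltnS => /leq_trans; apply; rewrite -subn_eq0 jk.
  have jn : (j.+1 < n.+1)%N by rewrite ltnS -subn_gt0 jk.
  rewrite -ltnS; apply: leq_trans (IHk (Ordinal jn) _); last by rewrite /= subnS jk.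
  by rewrite delta_inj_lt /=.
by apply/eqP; rewrite eqn_leq ge (le _ _ erefl).
Qed.

Lemma delta_lift l m n (nu : delta_hom l n) (f : delta_hom m n) :
  injective nu -> (forall i, exists j, nu j = f i) ->
  exists g, f = delta_comp nu g.
Proof.
move=> nu_inj /choice[g gE]; have g_homo : {homo g : i j / (i <= j)%N}.
  by move=> i j ij; rewrite leqNgt -(delta_inj_lt nu_inj) !gE -leqNgt delta_homo.
by exists (DeltaHom g_homo); apply: delta_hom_eq => i /=.
Qed.

Lemma coface_homo n (j : 'I_n.+2) : {homo lift j : i k / (i <= k)%N}.
Proof. by move=> i k ik /=; rewrite leq_bump2. Qed.

Definition coface n (j : 'I_n.+2) : delta_hom n n.+1 := DeltaHom (@coface_homo n j).

Lemma coface_inj n (j : 'I_n.+2) : injective (coface j).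
Proof. exact: lift_inj. Qed.

Lemma coface_factor m n (f : delta_hom m n.+1) j : (forall i, f i != j) ->
  exists g, f = delta_comp (coface j) g.
Proof.
move=> fj; apply: delta_lift; first exact: coface_inj.
by move=> i; case: (unliftP j (f i)) (fj i) => [k -> _|->]; [exists k|rewrite eqxx].
Qed.

Section simplicial.
Variable K : simplicial_set.

(** [f] ranges over all operators to a smaller ordinal; factoring [f] into a surjection and an
    injection shows that this is the usual notion. *)
Definition nondegenerate_cell n (z : K n) :=
  forall m (y : K m) (f : delta_hom n m), (m < n)%N -> z <> cell_map f y.

Lemma nondegenerate_or_degenerate n (x : K n) : nondegenerate_cell x \/
  exists m (y : K m) (f : delta_hom n m), (m < n)%N /\ x = cell_map f y.
Proof.
have [?|d] := pselect (nondegenerate_cell x); [by left|right].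
apply: contra_notP d => nd m y f mn xE; apply: nd.
by exists m, y, f.
Qed.

(** Take [d] least such that [x] comes from dimension [d] by any operator. Minimality makes [z]
    nondegenerate, and a value missed by [e] would let [e] factor through a coface and lower [d]. *)
Lemma eilenberg_zilber n (x : K n) : exists d (z : K d) (e : delta_hom n d),
  [/\ nondegenerate_cell z, x = cell_map e z & forall j, exists i, e i = j].
Proof.
have xP : exists d, `[< exists (z : K d) (e : delta_hom n d), x = cell_map e z >].
  by exists n; apply/asboolP; exists x, (delta_id n); rewrite cell_map_id.
have [d /asboolP[z [e xE]] d_min] := ex_minnP xP; exists d, z, e; split=> //.
  move=> m y f md zE; move: md; rewrite ltnNge d_min//; apply/asboolP.
  by exists y, (delta_comp f e); rewrite cell_map_comp -zE.
move=> j; apply: contrapT => ej; have {}ej i : e i != j.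
  by apply/eqP => eij; apply: ej; exists i.
case: d j z e xE d_min ej => [|d] j z e xE d_min ej.
  by have := ej ord0; rewrite (ord1 j) (ord1 (e ord0)) eqxx.
have [g eE] := coface_factor ej.
suff /d_min : `[< exists (z : K d) (e : delta_hom n d), x = cell_map e z >].
  by rewrite ltnn.
by apply/asboolP; exists (cell_map (coface j) z), g; rewrite xE eE cell_map_comp.
Qed.

(** If [e] missed a value, [z] would come from dimension [d - 1]. Hence [e] has a section, which is
    monotone and injective, so the identity. *)
Lemma nondegenerate_endo d (z y : K d) (e : delta_hom d d) :
  nondegenerate_cell z -> z = cell_map e y -> e = delta_id d.
Proof.
move=> nd zE; have /choice[g gE] : forall j, exists i, e i = j.
  move=> j; apply: contrapT => ej; have {}ej i : e i != j.
    by apply/eqP => eij; apply: ej; exists i.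
  case: d j z y e nd zE ej => [|d] j z y e nd zE ej.
    by have := ej ord0; rewrite (ord1 j) (ord1 (e ord0)) eqxx.
  have [g eE] := coface_factor ej.
  by apply: (nd d (cell_map (coface j) y) g) => //; rewrite -cell_map_comp -eE.
have g_homo : {homo g : i j / (i <= j)%N}.
  move=> i j; rewrite leq_eqVlt => /orP[/eqP/ord_inj->//|ij].
  apply: ltnW; rewrite ltnNge; apply: contraL ij => /(@delta_homo _ _ e).
  by rewrite !gE -leqNgt.
have g_inj : injective (DeltaHom g_homo) by move=> i j /(congr1 e); rewrite /= !gE.
have /(congr1 (@delta_fun _ _)) /= g_id := delta_inj_id g_inj.
by apply: delta_hom_eq => i; rewrite -[i in LHS]/(id i) -g_id gE.
Qed.

(** The freedom to prescribe one value of the section lets a surjection be recovered from its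
    sections in [eilenberg_zilber_unique]. *)
Lemma delta_section n d (e : delta_hom n d) : (forall j, exists i, e i = j) ->
  forall i, exists h : delta_hom d n, delta_comp e h = delta_id d /\ h (e i) = i.
Proof.
move=> /choice[g gE] i; pose h j := if j == e i then i else g j.
have hE j : e (h j) = j by rewrite /h; case: eqP => [->//|_]; rewrite gE.
have h_homo : {homo h : j k / (j <= k)%N}.
  move=> j k; rewrite leq_eqVlt => /orP[/eqP/ord_inj->//|jk].
  apply: ltnW; rewrite ltnNge; apply: contraL jk => /(@delta_homo _ _ e).
  by rewrite !hE -leqNgt.
exists (DeltaHom h_homo); split; last by rewrite /= /h eqxx.
by apply: delta_hom_eq => j /=; rewrite hE.
Qed.

(** Pulling back along a section [h] of [e] gives [z = cell_map (delta_comp e' h) z']. This bounds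
    the dimensions, then forces [delta_comp e' h] to be the identity; a section through [i] yields
    [e' i = e i]. *)
Lemma eilenberg_zilber_unique n d d' (z : K d) (z' : K d') (e : delta_hom n d)
    (e' : delta_hom n d') :
  nondegenerate_cell z -> nondegenerate_cell z' ->
  (forall j, exists i, e i = j) -> (forall j, exists i, e' i = j) ->
  cell_map e z = cell_map e' z' ->
  existT (fun d => (K d * delta_hom n d)%type) d (z, e) = existT _ d' (z', e').
Proof.
move=> nd nd' eS eS' ee'.
have le a b (y : K a) (y' : K b) (f : delta_hom n a) (f' : delta_hom n b) :
    nondegenerate_cell y -> (forall j, exists i, f i = j) ->
    cell_map f y = cell_map f' y' -> (a <= b)%N.
  move=> ndy fS yE; rewrite leqNgt; apply/negP => ba.
  have [h [fh _]] := delta_section fS ord0.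
  apply: (ndy _ y' (delta_comp f' h) ba).
  by rewrite cell_map_comp -yE -cell_map_comp fh cell_map_id.
have dd' : d = d' by apply/eqP; rewrite eqn_leq (le _ _ _ _ _ _ nd eS ee')
  (le _ _ _ _ _ _ nd' eS' (esym ee')).
case: _ / dd' z' e' nd' eS' ee' => z' e' nd' eS' ee'.
have e'h (h : delta_hom d n) : delta_comp e h = delta_id d ->
    z = cell_map (delta_comp e' h) z' /\ delta_comp e' h = delta_id d.
  move=> eh; have zE : z = cell_map (delta_comp e' h) z'.
    by rewrite cell_map_comp -ee' -cell_map_comp eh cell_map_id.
  by split=> //; exact: nondegenerate_endo zE.
have -> : e = e'.
  apply: delta_hom_eq => i; have [h [/e'h[_ /(congr1 (@delta_fun _ _))]]] := delta_section eS i.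
  by move=> /(congr1 (@^~ (e i))) /= + hi; rewrite hi.
have [h [/e'h[-> ->] _]] := delta_section eS ord0.
by rewrite cell_map_id.
Qed.
End simplicial.

(** * Barycentric coordinates and cuts *)

Section barycentric.
Variable R : realType.
Implicit Types m n k : nat.

(* [t] cuts [0, 1] into blocks of lengths [t_0, ..., t_n]; [cum t j] is the j-th cut.
   Cosimplicial operators act by forgetting and repeating cuts. *)
Definition cum n (t : 'rV[R]_n.+1) (j : nat) : R := \sum_(i < n.+1 | (i < j)%N) t ord0 i.

Definition row_cum n (C : nat -> R) : 'rV[R]_n.+1 := \row_i (C i.+1 - C i).

Lemma cum0 n (t : 'rV[R]_n.+1) : cum t 0 = 0.
Proof. by rewrite /cum big1. Qed.

Lemma cumS n (t : 'rV[R]_n.+1) (i : 'I_n.+1) : cum t i.+1 = cum t i + t ord0 i.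
Proof.
rewrite /cum (bigD1 i)/= ?ltnS// addrC; congr (_ + _); apply: eq_bigl => j.
by rewrite ltnS ltn_neqAle andbC.
Qed.

Lemma cum_ge n (t : 'rV[R]_n.+1) j : (n < j)%N -> cum t j = \sum_i t ord0 i.
Proof. by move=> nj; apply: eq_bigl => i; rewrite (leq_trans (ltn_ord i) nj). Qed.

Lemma cum1 n (t : 'rV[R]_n.+1) j : simplex R n t -> (n < j)%N -> cum t j = 1.
Proof. by move=> [_ t1] /cum_ge ->. Qed.

Lemma cum_row_cum n C j : (j <= n.+1)%N -> cum (row_cum n C) j = C j - C 0%N.
Proof.
elim: j => [|j IHj] jn; first by rewrite cum0 subrr.
by rewrite (cumS _ (Ordinal jn)) IHj 1?ltnW// mxE /= addrC subrKA.
Qed.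

Lemma eq_cum n (t t' : 'rV[R]_n.+1) : (forall j, (j <= n.+1)%N -> cum t j = cum t' j) -> t = t'.
Proof.
move=> tt'; apply/rowP => i.
by have := cumS t i; rewrite !tt'// 1?ltnW// cumS => /addrI <-.
Qed.

Lemma cum_le n (t : 'rV[R]_n.+1) i j : simplex R n t -> (i <= j)%N -> cum t i <= cum t j.
Proof.
move=> [t0 _] ij; rewrite /cum [leRHS](bigID (fun k : 'I_n.+1 => (k < i)%N))/=.
rewrite [X in _ <= X + _](eq_bigl (fun k : 'I_n.+1 => (k < i)%N)) ?lerDl ?sumr_ge0// => k.
by case: (ltnP k i) => ki; rewrite ?andbF// andbT (leq_trans ki ij).
Qed.

Lemma cum_itv n (t : 'rV[R]_n.+1) j : simplex R n t -> 0 <= cum t j <= 1.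
Proof.
move=> st; rewrite -{1}(cum0 t) cum_le//= -(cum1 st (leq_maxl n.+1 j)).
by rewrite cum_le// leq_maxr.
Qed.

Lemma simplex_row_cum n C : C 0%N = 0 -> C n.+1 = 1 ->
  (forall j, (j <= n)%N -> C j <= C j.+1) -> simplex R n (row_cum n C).
Proof.
move=> C0 C1 Cle; split=> [i|]; first by rewrite mxE subr_ge0 Cle// -ltnS.
by rewrite -(@cum_ge _ _ n.+1)// cum_row_cum// C0 C1 subr0.
Qed.

(** The preimage of an initial segment under a monotone map is an initial segment, and [N] is its
    cardinality. By [cum_push] it is the index of the cut of [t] that becomes the k-th cut of
    [push_row f t]. *)
Lemma delta_cut m n (f : delta_hom m n) k : exists N, forall i, (f i < k)%N = (i < N)%N.
Proof.
have widen_inj p q (pq : (p <= q)%N) : injective (widen_ord pq).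
  by move=> i j /(congr1 val)/= /ord_inj.
exists #|[pred i | (f i < k)%N]| => i; apply/idP/idP => [fik|].
  rewrite -[X in (X <= _)%N](card_ord i.+1) -(card_imset _ (widen_inj _ m.+1 (ltn_ord i))).
  apply: subset_leq_card. apply/fintype.subsetP => j /imsetP[l _ ->]; rewrite inE /=.
  by apply: leq_ltn_trans fik; apply: delta_homo; rewrite /= -ltnS.
apply: contraTT; rewrite -!leqNgt => fik; rewrite -[leqRHS](card_ord i).
rewrite -(card_imset _ (widen_inj _ m.+1 (ltnW (ltn_ord i)))).
apply: subset_leq_card; apply/fintype.subsetP => j; rewrite inE => fjk.
have ji : (j < i)%N.
  rewrite ltnNge; apply/negP => /(@delta_homo _ _ f) fij.
  by have := leq_ltn_trans fij fjk; rewrite ltnNge fik.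
by apply/imsetP; exists (Ordinal ji) => //; exact/val_inj.
Qed.

Lemma cum_push m n (f : delta_hom m n) (t : 'rV[R]_m.+1) k N :
  (forall i, (f i < k)%N = (i < N)%N) -> cum (push_row f t) k = cum t N.
Proof.
move=> fkN; rewrite /cum (partition_big f (fun j : 'I_n.+1 => (j < k)%N))/=; last first.
  by move=> i; rewrite -fkN.
apply: eq_bigr => j jk; rewrite mxE; apply: eq_bigl => i.
by rewrite -fkN; case: eqP => [->|]; rewrite ?jk ?andbF.
Qed.

Lemma push_row_comp l m n (g : delta_hom m n) (f : delta_hom l m) (t : 'rV[R]_l.+1) :
  push_row (delta_comp g f) t = push_row g (push_row f t).
Proof.
apply: eq_cum => k _; have [M gM] := delta_cut g k; have [N fN] := delta_cut f M.
rewrite (cum_push _ gM) (cum_push _ fN) (@cum_push _ _ (delta_comp g f) _ k N)// => i.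
by rewrite /= gM fN.
Qed.

Lemma push_row_id n (t : 'rV[R]_n.+1) : push_row (delta_id n) t = t.
Proof. by apply: eq_cum => k _; exact: cum_push. Qed.

Lemma push_row_inj m n (f : delta_hom m n) (t : 'rV[R]_m.+1) i : injective f ->
  push_row f t ord0 (f i) = t ord0 i.
Proof.
move=> f_inj; rewrite mxE (eq_bigl (pred1 i)) ?big_pred1_eq// => j /=.
exact: inj_eq.
Qed.

Lemma push_row_out m n (f : delta_hom m n) (t : 'rV[R]_m.+1) j :
  (forall i, f i != j) -> push_row f t ord0 j = 0.
Proof. by move=> fj; rewrite mxE big1// => i /eqP; move/eqP: (fj i). Qed.

Definition interior_point n (t : 'rV[R]_n.+1) := forall i, 0 < t ord0 i.

(** The image of [f] can thus be read off from a pushed interior point; this yields the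
    factorisations through supporting faces. *)
Lemma push_row_gt0 m n (f : delta_hom m n) (t : 'rV[R]_m.+1) j : interior_point t ->
  (0 < push_row f t ord0 j) <-> exists i, f i = j.
Proof.
move=> t_gt0; split=> [|[i fij]].
  apply: contraPP => fj; rewrite push_row_out ?ltxx// => i.
  by apply/eqP => fij; apply: fj; exists i.
rewrite mxE (bigD1 i)/=; last exact/eqP.
by rewrite ltr_pwDl// sumr_ge0// => k _; exact: ltW.
Qed.

Definition face_row n (j : 'I_n.+2) (t : 'rV[R]_n.+2) : 'rV[R]_n.+1 :=
  \row_i t ord0 (lift j i).

Lemma push_face_row n (j : 'I_n.+2) (t : 'rV[R]_n.+2) : t ord0 j = 0 ->
  push_row (coface j) (face_row j t) = t.
Proof.
move=> tj; apply/rowP => k; case: (unliftP j k) => [i|] ->.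
  by rewrite (push_row_inj _ _ (@coface_inj n j)) mxE.
by rewrite push_row_out ?tj// => i; rewrite eq_sym; exact: neq_lift.
Qed.

Lemma simplex_face_row n (j : 'I_n.+2) (t : 'rV[R]_n.+2) : t ord0 j = 0 ->
  simplex R n.+1 t -> simplex R n (face_row j t).
Proof.
move=> tj [t0 t1]; split=> [i|]; first by rewrite mxE.
by rewrite -t1 (bigD1_ord j)//= tj add0r; apply: eq_bigr => i _; rewrite mxE.
Qed.

(** Induction on the dimension: a point with a vanishing coordinate lies on the corresponding
    face. *)
Lemma simplex_push_interior n (t : 'rV[R]_n.+1) : simplex R n t ->
  exists k (nu : delta_hom k n) (t' : 'rV[R]_k.+1),
  [/\ injective nu, simplex R k t', interior_point t' & t = push_row nu t'].
Proof.
elim: n t => [|n IHn] t st.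
  exists 0%N, (delta_id 0), t; split=> //; last by rewrite push_row_id.
  by move=> i; case: st => _; rewrite big_ord1 (ord1 i) => ->.
have [t0|] := pselect (interior_point t).
  by exists n.+1, (delta_id _), t; split=> //; rewrite push_row_id.
move=> /existsNP[j /negP]; rewrite -leNgt => tj.
have {}tj : t ord0 j = 0 by apply/eqP; rewrite eq_le tj; case: st => ->.
have [k [nu [t' [nu_inj st' t'0 tE]]]] := IHn _ (simplex_face_row tj st).
exists k, (delta_comp (coface j) nu), t'; split=> //.
  by apply: inj_comp => //; exact: coface_inj.
by rewrite push_row_comp -tE push_face_row.
Qed.

Definition cuts n (t : 'rV[R]_n.+1) : set R := range (cum t).

Lemma cuts_push_sub m n (f : delta_hom m n) (t : 'rV[R]_m.+1) :
  cuts (push_row f t) `<=` cuts t.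
Proof.
by move=> _ [k _ <-]; have [N fN] := delta_cut f k; exists N; rewrite ?(cum_push _ fN).
Qed.

(** An injective operator repeats cuts but forgets none, so the set of cuts is well defined on the
    thick realisation. *)
Lemma cuts_push m n (f : delta_hom m n) (t : 'rV[R]_m.+1) : injective f ->
  cuts (push_row f t) = cuts t.
Proof.
move=> f_inj; apply/seteqP; split; first exact: cuts_push_sub.
move=> _ [i _ <-]; case: (ltnP i m.+1) => im.
  exists (f (Ordinal im)) => //; apply: cum_push => j.
  by rewrite (delta_inj_lt f_inj).
exists n.+1 => //; rewrite (@cum_ge _ t i)// -(@cum_ge _ t m.+1)//.
by apply: cum_push => j; rewrite !ltn_ord.
Qed.

Lemma cuts_fixed n (t : 'rV[R]_n.+1) : simplex R n t -> cuts t 0 /\ cuts t 1.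
Proof. by move=> st; split; [exists 0%N; rewrite ?cum0|exists n.+1; rewrite ?cum1]. Qed.

Lemma cum_lt n (t : 'rV[R]_n.+1) i j : interior_point t -> (j <= n.+1)%N -> (i < j)%N ->
  cum t i < cum t j.
Proof.
move=> t0 + ij; elim: j ij => [//|j IHj]; rewrite ltnS leq_eqVlt => /orP[/eqP->|ij] jn.
  by rewrite (cumS t (Ordinal jn)) ltrDl.
by apply: lt_trans (IHj ij (ltnW jn)) _; rewrite (cumS t (Ordinal jn)) ltrDl.
Qed.

(** The cuts of an interior point increase strictly, so their list is determined by their set. *)
Lemma eq_cuts n n' (t : 'rV[R]_n.+1) (t' : 'rV[R]_n'.+1) :
  simplex R n t -> simplex R n' t' -> interior_point t -> interior_point t' ->
  cuts t = cuts t' -> existT (fun n => 'rV[R]_n.+1) n t = existT _ n' t'.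
Proof.
move=> st st' t0 t'0 tt'.
have srt k (u : 'rV[R]_k.+1) : interior_point u ->
    sorted <%R [seq cum u j | j <- iota 0 k.+2].
  move=> u0; rewrite sorted_map; apply/(sortedP 0%N) => i; rewrite size_iota => ik.
  by rewrite !nth_iota//= ?add0n; [rewrite cum_lt|exact: ltnW].
have memE k (u : 'rV[R]_k.+1) x : simplex R k u ->
    (x \in [seq cum u j | j <- iota 0 k.+2]) <-> cuts u x.
  move=> su; split=> [/mapP[j _ ->]|[j _ <-]]; first by exists j.
  apply/mapP; exists (minn j k.+1).
    by rewrite mem_iota /= add0n ltnS geq_minr.
  by case: (leqP j k.+1) => // /ltnW kj; rewrite !cum1.
have E : [seq cum t j | j <- iota 0 n.+2] = [seq cum t' j | j <- iota 0 n'.+2].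
  apply: lt_sorted_eq; [exact: srt|exact: srt|move=> x].
  by apply/idP/idP => /memE ux; apply/memE => //; move: (ux ltac:(by [])); rewrite tt'.
have /eqP : size [seq cum t j | j <- iota 0 n.+2] = size [seq cum t' j | j <- iota 0 n'.+2].
  by rewrite E.
rewrite !size_map !size_iota !eqSS => /eqP nn'; case: _ / nn' t' st' t'0 tt' E => t' _ _ _ E.
congr existT; apply: eq_cum => j jn.
have := congr1 (fun s => nth 0 s j) E.
by rewrite !(nth_map 0%N) ?size_iota// !nth_iota.
Qed.

(** If [f i < k <= g i], the k-th cuts of the two images are cuts of [t] on different sides of the
    block [i], which has positive length. *)
Lemma eq_push_interior m n (e e' : delta_hom m n) (t : 'rV[R]_m.+1) :
  interior_point t -> push_row e t = push_row e' t -> e = e'.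
Proof.
move=> t0 ee'; apply: delta_hom_eq => i; apply/val_inj => /=.
have lt (f g : delta_hom m n) k : push_row f t = push_row g t -> (f i < k)%N -> (g i < k)%N.
  move=> fg; have [M fM] := delta_cut f k; have [N gN] := delta_cut g k.
  rewrite fM gN => iM; rewrite ltnNge; apply/negP => Ni.
  have := congr1 (fun u => cum u k) fg; rewrite (cum_push _ fM) (cum_push _ gN).
  (* Indices are truncated at [m.+1]: [cum t] is strictly increasing up to there and constant
     beyond. *)
  have cum_min L : cum t L = cum t (minn L m.+1).
    by case: (leqP L m.+1) => // /ltnW ?; rewrite !cum_ge.
  rewrite (cum_min M) (cum_min N) => /eqP; rewrite gt_eqF// cum_lt ?geq_minr//.
  by rewrite gtn_min !leq_min; apply/orP; left; rewrite (leq_ltn_trans Ni iM) (leq_ltn_trans Ni).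
apply/eqP; rewrite eqn_leq -ltnS (lt e' e) ?ltnS//=.
by rewrite -ltnS (lt e e').
Qed.

End barycentric.

(** * Normal forms of points *)

Section points.
Variable R : realType.

(** The vertex 0, all of whose cuts after the first are 1. It is the default value of
    [to_simplex]. *)
Definition vertex n : 'rV[R]_n.+1 := row_cum n (fun j => (0 < j)%N%:R).

Lemma simplex_vertex n : simplex R n (vertex n).
Proof. by apply: simplex_row_cum => // j _; rewrite ler_nat; case: j. Qed.

(** Being total, it allows the coordinates of a moving point to be a row-valued function that lies
    in the simplex only on some subset. *)
Definition to_simplex n (t : 'rV[R]_n.+1) : simplex R n :=
  match pselect (simplex R n t) with
  | left h => SigSub (mem_set h)
  | right _ => SigSub (mem_set (simplex_vertex n))
  end.

Lemma to_simplexK n (t : 'rV[R]_n.+1) : simplex R n t -> \val (to_simplex t) = t.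
Proof. by rewrite /to_simplex; case: pselect. Qed.

Lemma val_simplex n (t : simplex R n) : simplex R n (\val t).
Proof. exact/set_mem/valP. Qed.

Lemma to_simplex_val n (t : simplex R n) : to_simplex (\val t) = t.
Proof. by apply/val_inj; rewrite /= to_simplexK//; exact: val_simplex. Qed.

Lemma simplex_map_to m n (f : delta_hom m n) (t : 'rV[R]_m.+1) : simplex R m t ->
  simplex_map f (to_simplex t) = to_simplex (push_row f t).
Proof.
move=> st; apply/val_inj; rewrite to_simplexK /= ?to_simplexK//.
exact: push_row_simplex.
Qed.

Variable K : simplicial_set.

Definition thin n (x : K n) (t : 'rV[R]_n.+1) : realisation R K :=
  thin_class (cell_point x (to_simplex t)).

Definition thick n (x : K n) (t : 'rV[R]_n.+1) : thick_realisation R K :=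
  thick_class (cell_point x (to_simplex t)).

Lemma thick_proj_thick n (x : K n) t : thick_proj (thick x t) = thin x t.
Proof. exact: thick_projE. Qed.

Lemma thin_glue m n (f : delta_hom m n) (x : K n) t : simplex R m t ->
  thin (cell_map f x) t = thin x (push_row f t).
Proof.
move=> st; by apply/coend_eqP/rst_step; rewrite -simplex_map_to//; exact: CoendGlue.
Qed.

Lemma thick_glue m n (f : delta_hom m n) (x : K n) t : injective f -> simplex R m t ->
  thick (cell_map f x) t = thick x (push_row f t).
Proof.
move=> f_inj st; by apply/coend_eqP/rst_step; rewrite -simplex_map_to//; exact: CoendGlue.
Qed.

Lemma thinP (xi : realisation R K) : exists n (x : K n) t, simplex R n t /\ xi = thin x t.
Proof.
elim/quotW: xi => -[n [x t]]; exists n, x, (\val t); split; first exact: val_simplex.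
by rewrite /thin to_simplex_val.
Qed.

Lemma thickP (a : thick_realisation R K) :
  exists n (x : K n) t, simplex R n t /\ a = thick x t.
Proof.
elim/quotW: a => -[n [x t]]; exists n, x, (\val t); split; first exact: val_simplex.
by rewrite /thick to_simplex_val.
Qed.

(** Equality of classes is the equivalence generated by [coend_glue], so invariance under a single
    glueing suffices. Functions and predicates descend to the realisations in this way. *)
Lemma glue_invariant (S : forall m n, delta_hom m n -> Prop) (T : Type)
    (F : forall n, K n -> 'rV[R]_n.+1 -> T) :
  (forall m n (f : delta_hom m n) x t, S m n f -> simplex R m t ->
    F _ (cell_map f x) t = F _ x (push_row f t)) ->
  forall m n (x : K m) (y : K n) t u, simplex R m t -> simplex R n u ->
  clos_refl_sym_trans _ (coend_glue S)
    (cell_point x (to_simplex t)) (cell_point y (to_simplex u)) ->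
  F _ x t = F _ y u.
Proof.
move=> Fglue m n x y t u st su xy.
suff : forall p q : cell_points R K, clos_refl_sym_trans _ (coend_glue S) p q ->
    F _ (projT2 p).1 (\val (projT2 p).2) = F _ (projT2 q).1 (\val (projT2 q).2).
  by move=> /(_ _ _ xy)/=; rewrite !to_simplexK.
move=> p q; elim=> {p q xy} [_ _ [k l f z v Sf]|//|p q _ ->//|p q r _ -> _ ->//].
by rewrite Fglue//; exact: val_simplex.
Qed.

Lemma thin_invariant (T : Type) (F : forall n, K n -> 'rV[R]_n.+1 -> T) :
  (forall m n (f : delta_hom m n) x t, simplex R m t ->
    F _ (cell_map f x) t = F _ x (push_row f t)) ->
  forall m n (x : K m) (y : K n) t u, simplex R m t -> simplex R n u ->
  thin x t = thin y u -> F _ x t = F _ y u.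
Proof.
move=> Fglue m n x y t u st su /coend_eqP.
by apply: glue_invariant => // k l f z v _; exact: Fglue.
Qed.

Lemma thick_invariant (T : Type) (F : forall n, K n -> 'rV[R]_n.+1 -> T) :
  (forall m n (f : delta_hom m n) x t, injective f -> simplex R m t ->
    F _ (cell_map f x) t = F _ x (push_row f t)) ->
  forall m n (x : K m) (y : K n) t u, simplex R m t -> simplex R n u ->
  thick x t = thick y u -> F _ x t = F _ y u.
Proof. by move=> Fglue m n x y t u st su /coend_eqP; exact: glue_invariant. Qed.

(* [t] lies over [t'] in the interior of its supporting face [nu], and
   [z, e] is the Eilenberg-Zilber decomposition of that face of [x]. *)
Definition normal_form n (x : K n) (t : 'rV[R]_n.+1) d (z : K d) (s : 'rV[R]_d.+1) :=
  exists k (nu : delta_hom k n) (e : delta_hom k d) (t' : 'rV[R]_k.+1),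
  [/\ injective nu, simplex R k t', interior_point t' & t = push_row nu t'] /\
  [/\ nondegenerate_cell z, forall j, exists i, e i = j, cell_map nu x = cell_map e z &
    s = push_row e t'].

Lemma normal_form_exists n (x : K n) t : simplex R n t ->
  exists d (z : K d) s, normal_form x t z s.
Proof.
move=> /simplex_push_interior[k [nu [t' [nu_inj st' t'0 tE]]]].
have [d [z [e [nd xz eS]]]] := eilenberg_zilber (cell_map nu x).
by exists d, z, (push_row e t'), k, nu, e, t'.
Qed.

Lemma normal_form_interior n (x : K n) t d (z : K d) s : normal_form x t z s ->
  [/\ nondegenerate_cell z, simplex R d s, interior_point s & thin x t = thin z s].
Proof.
move=> [k [nu [e [t' [[nu_inj st' t'0 ->] [nd eS xz ->]]]]]]; split=> //.
- exact: push_row_simplex.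
- by move=> j; apply/push_row_gt0.
- by rewrite -!thin_glue// xz.
Qed.

Lemma normal_form_dim n (x : K n) t d (z : K d) s : normal_form x t z s -> (d <= n)%N.
Proof.
move=> [k [nu [e [t' [[nu_inj _ _ _] [_ eS _ _]]]]]].
have le1 : (k.+1 <= n.+1)%N.
  by rewrite -[leqLHS]card_ord -[leqRHS]card_ord; exact: leq_card nu_inj.
have le2 : (d.+1 <= k.+1)%N.
  rewrite -[leqLHS]card_ord -[leqRHS]card_ord.
  have /choice[g gE] := eS; apply: (leq_card g).
  by move=> i j /(congr1 e); rewrite !gE.
exact: leq_trans le2 le1.
Qed.

(** The support of [t] determines the face: each of [nu] and [nu'] factors through the other. With
    [g] the comparison map, [e] and [delta_comp e' g] decompose the same cell, and Eilenberg-Zilber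
    uniqueness applies. *)
Lemma normal_form_unique n (x : K n) t d d' (z : K d) s (z' : K d') s' :
  normal_form x t z s -> normal_form x t z' s' ->
  existT (fun d => (K d * 'rV[R]_d.+1)%type) d (z, s) = existT _ d' (z', s').
Proof.
move=> [k [nu [e [u [[nu_inj su u0 tE] [nd eS xz ->]]]]]].
move=> [k' [nu' [e' [u' [[nu'_inj su' u'0 tE'] [nd' e'S xz' ->]]]]]].
have img a b (f : delta_hom a n) (g : delta_hom b n) (v : 'rV[R]_a.+1) (w : 'rV[R]_b.+1) :
    interior_point v -> interior_point w -> t = push_row f v -> t = push_row g w ->
    forall i, exists j, g j = f i.
  move=> v0 w0 tf tg i; apply/(push_row_gt0 g _ w0); rewrite -tg tf.
  by apply/push_row_gt0 => //; exists i.
have [g nuE] := delta_lift nu'_inj (img _ _ _ _ _ _ u0 u'0 tE tE').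
have [g' nu'E] := delta_lift nu_inj (img _ _ _ _ _ _ u'0 u0 tE' tE).
have gS j : exists i, g i = j.
  exists (g' j); apply: nu'_inj.
  by rewrite -[nu' (g _)]/(delta_comp nu' g (g' j)) -nuE [in RHS]nu'E.
have u'E : u' = push_row g u.
  apply/rowP => j; rewrite -(push_row_inj u' _ nu'_inj) -tE' tE nuE push_row_comp.
  by rewrite push_row_inj.
have e'gS j : exists i, delta_comp e' g i = j.
  have [i <-] := e'S j; have [l <-] := gS i.
  by exists l.
have ee' : cell_map e z = cell_map (delta_comp e' g) z'.
  by rewrite -xz nuE !cell_map_comp xz'.
have := eilenberg_zilber_unique nd nd' eS e'gS ee'.
(* Mapping [F] over the equality replaces each degeneracy by the point to which it pushes [u]. *)
pose F (p : {d & (K d * delta_hom k d)%type}) :=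
  existT (fun d => (K d * 'rV[R]_d.+1)%type) (projT1 p) ((projT2 p).1, push_row (projT2 p).2 u).
by move=> /(congr1 F); rewrite /F /= push_row_comp -u'E.
Qed.

(** From right to left, the supporting face of [t] maps onto that of [push_row f t], and the
    degeneracies compose. The converse follows from this by existence and uniqueness. *)
Lemma normal_form_push m n (f : delta_hom m n) (x : K n) t d (z : K d) s :
  simplex R m t -> normal_form (cell_map f x) t z s <-> normal_form x (push_row f t) z s.
Proof.
move=> st; have sft := push_row_simplex f st.
have bwd d' (z' : K d') s' : normal_form x (push_row f t) z' s' ->
    normal_form (cell_map f x) t z' s'.
  move=> [k' [nu' [e [u' [[nu'_inj su' u'0 ftE] [nd eS xz ->]]]]]].
  have [k [nu [u [nu_inj su u0 tE]]]] := simplex_push_interior st.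
  have ftE' : push_row (delta_comp f nu) u = push_row nu' u'.
    by rewrite push_row_comp -tE.
  have /(delta_lift nu'_inj)[g fnuE] i : exists j, nu' j = delta_comp f nu i.
    by apply/(push_row_gt0 nu' _ u'0); rewrite -ftE'; apply/push_row_gt0 => //; exists i.
  have u'E : u' = push_row g u.
    apply/rowP => j; rewrite -(push_row_inj u' _ nu'_inj) -ftE' fnuE push_row_comp.
    by rewrite push_row_inj.
  exists k, nu, (delta_comp e g), u; split=> //; split=> //.
  - move=> j; have [i <-] := eS j.
    have /(push_row_gt0 g _ u0)[l <-] : 0 < push_row g u ord0 i by rewrite -u'E.
    by exists l.
  - by rewrite -cell_map_comp fnuE !cell_map_comp xz.
  - by rewrite push_row_comp -u'E.
split=> [nf|]; last exact: bwd.
have [d' [z' [s' nf']]] := normal_form_exists x sft.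
pose G (p : {d & (K d * 'rV[R]_d.+1)%type}) :=
  normal_form x (push_row f t) (projT2 p).1 (projT2 p).2.
have := normal_form_unique nf (bwd _ _ _ nf').
by move=> /(congr1 G); rewrite /G /= => ->.
Qed.

Lemma thin_normal_form n (x : K n) t n' (x' : K n') t' d (z : K d) s :
  simplex R n t -> simplex R n' t' -> thin x t = thin x' t' ->
  normal_form x t z s -> normal_form x' t' z s.
Proof.
move=> st st' xx' nf.
suff -> : normal_form x' t' z s = normal_form x t z s by [].
apply/esym/(@thin_invariant _ (fun n (x : K n) t => normal_form x t z s)) => // k m f y u su.
by apply/propext; exact: normal_form_push.
Qed.

Lemma normal_form_refl d (z : K d) s : nondegenerate_cell z -> simplex R d s ->
  interior_point s -> normal_form z s z s.
Proof.
move=> nd ss s0; exists d, (delta_id d), (delta_id d), s; rewrite push_row_id cell_map_id.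
by split=> //; split=> // j; exists j.
Qed.

Lemma thin_interior_inj d d' (z : K d) s (z' : K d') s' :
  nondegenerate_cell z -> simplex R d s -> interior_point s ->
  nondegenerate_cell z' -> simplex R d' s' -> interior_point s' ->
  thin z s = thin z' s' ->
  existT (fun d => (K d * 'rV[R]_d.+1)%type) d (z, s) = existT _ d' (z', s').
Proof.
move=> nd ss s0 nd' ss' s'0 zz'.
have nf := thin_normal_form ss ss' zz' (normal_form_refl nd ss s0).
exact: normal_form_unique nf (normal_form_refl nd' ss' s'0).
Qed.

Lemma thick_interior (a : thick_realisation R K) : exists n (x : K n) t,
  [/\ simplex R n t, interior_point t & a = thick x t].
Proof.
have [n [x [t [st ->]]]] := thickP a.
have [k [nu [u [nu_inj su u0 tE]]]] := simplex_push_interior st.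
by exists k, (cell_map nu x), u; rewrite tE thick_glue.
Qed.

Definition thick_cuts (a : thick_realisation R K) : set R :=
  cuts (\val (projT2 (repr (a : coend R K in_Upsilon))).2).

Lemma thick_cutsE n (x : K n) t : simplex R n t -> thick_cuts (thick x t) = cuts t.
Proof.
move=> st; rewrite /thick_cuts.
have : thick_class (repr (thick x t : coend R K in_Upsilon)) = thick x t.
  exact: reprK.
case: (repr _) => m [y u] /=; rewrite -[u]to_simplex_val => E.
rewrite to_simplex_val; apply: (@thick_invariant _ (fun n (x : K n) t => cuts t) _ _ _ y x) => //.
- by move=> k l f z v f_inj _; rewrite cuts_push.
- exact: val_simplex.
Qed.

(* ||K|| consists of the pairs of a point of |K| and a finite subset of [0, 1] which
   contains the cuts of the normal form of that point. *)
Lemma thick_inj (a b : thick_realisation R K) :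
  thick_proj a = thick_proj b -> thick_cuts a = thick_cuts b -> a = b.
Proof.
have [n [x [t [st t0 ->]]]] := thick_interior a.
have [m [y [u [su u0 ->]]]] := thick_interior b.
rewrite !thick_proj_thick !thick_cutsE// => xy /(eq_cuts st su t0 u0) tu.
(* [P] quantifies over the cell, so that it can be transported along the equality of [t] and [u],
   whose dimensions are a priori different. *)
pose P k (v : 'rV[R]_k.+1) := forall y : K k, simplex R k v -> interior_point v ->
   thin x t = thin y v -> thick x t = thick y v.
suff Pu : P m u by exact: Pu.
have -> : P m u = (fun p : {k & 'rV[R]_k.+1} => P (projT1 p) (projT2 p)) (existT _ m u) by [].
rewrite -tu /= => {}y _ _ {}xy; congr thick.
(* Pushed to nondegenerate cells, [t] stays interior, so the two resulting normal forms agree;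
   [eq_push_interior] then recovers the degeneracy from the pushed point. *)
have [d [z [e [nd xz eS]]]] := eilenberg_zilber x.
have [d' [z' [e' [nd' yz' e'S]]]] := eilenberg_zilber y.
have gt0 k (f : delta_hom n k) : (forall j, exists i, f i = j) -> interior_point (push_row f t).
  by move=> fS j; apply/push_row_gt0.
have := @thin_interior_inj d d' z (push_row e t) z' (push_row e' t) nd
  (push_row_simplex e st) (gt0 _ _ eS) nd' (push_row_simplex e' st) (gt0 _ _ e'S).
rewrite -!thin_glue// -xz -yz' => /(_ xy) E.
pose Q (p : {d & (K d * 'rV[R]_d.+1)%type}) := forall f : delta_hom n (projT1 p),
  (projT2 p).2 = push_row f t -> cell_map e z = cell_map f (projT2 p).1.
suff : Q (existT _ d' (z', push_row e' t)) by rewrite /Q /= xz yz'; exact.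
by rewrite -E => f /= /(eq_push_interior t0) ->.
Qed.

End points.

(** * Reparametrisation and refinement *)

Section refinement.
Variable R : realType.

Definition reparametrisation (h : R -> R) :=
  [/\ h 0 = 0, h 1 = 1 & forall x y, 0 <= x -> x <= y -> y <= 1 -> h x <= h y].

Definition row_act (h : R -> R) n (t : 'rV[R]_n.+1) := row_cum n (h \o cum t).

Lemma cum_row_act h n (t : 'rV[R]_n.+1) j : h 0 = 0 -> cum (row_act h t) j = h (cum t j).
Proof.
move=> h0; case: (leqP j n.+1) => jn; first by rewrite cum_row_cum//= cum0 h0 subr0.
rewrite (cum_ge t (ltnW jn)) -(cum_ge t (ltnSn n)) (cum_ge _ (ltnW jn)).
by rewrite -(cum_ge _ (ltnSn n)) cum_row_cum//= cum0 h0 subr0.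
Qed.

Lemma simplex_row_act h n (t : 'rV[R]_n.+1) : reparametrisation h -> simplex R n t ->
  simplex R n (row_act h t).
Proof.
move=> [h0 h1 hle] st; apply: simplex_row_cum => /= [||j jn].
- by rewrite cum0.
- by rewrite cum1.
- have /andP[? _] := cum_itv j st; have /andP[_ ?] := cum_itv j.+1 st.
  by apply: hle => //; exact: cum_le.
Qed.

Lemma push_row_act h m n (f : delta_hom m n) (t : 'rV[R]_m.+1) : h 0 = 0 ->
  push_row f (row_act h t) = row_act h (push_row f t).
Proof.
move=> h0; apply: eq_cum => k _; have [N fN] := delta_cut f k.
by rewrite cum_row_act// !(cum_push _ fN) cum_row_act.
Qed.

Lemma codegeneracy_subproof n (j : 'I_n.+1) (i : 'I_n.+2) : (i - (j < i) < n.+1)%N.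
Proof.
case: (ltnP j i) => ij; last by rewrite subn0 ltnS (leq_trans ij)// -ltnS.
by rewrite subn1 prednK ?(leq_ltn_trans _ ij)// -ltnS.
Qed.

Lemma codegeneracy_homo n (j : 'I_n.+1) :
  {homo (fun i => Ordinal (codegeneracy_subproof j i)) : i k / (i <= k)%N}.
Proof.
move=> i k ik /=; case: (ltnP j i) => ji; case: (ltnP j k) => jk.
- exact: leq_sub2r.
- by have := leq_trans ji ik; rewrite ltnNge jk.
- by rewrite subn0 subn1 -ltnS prednK ?(leq_ltn_trans _ jk)// (leq_ltn_trans ji jk).
- by rewrite !subn0.
Qed.

Definition codegeneracy n (j : 'I_n.+1) : delta_hom n.+1 n :=
  DeltaHom (@codegeneracy_homo n j).

Definition insert_cum n (j : 'I_n.+1) (c : R) (t : 'rV[R]_n.+1) (i : nat) : R :=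
  if (i <= j)%N then cum t i else if i == j.+1 then c else cum t i.-1.

Definition row_insert n (j : 'I_n.+1) (c : R) (t : 'rV[R]_n.+1) : 'rV[R]_n.+2 :=
  row_cum n.+1 (insert_cum j c t).

Lemma insert_cum_le n (j : 'I_n.+1) c (t : 'rV[R]_n.+1) i : (i <= j)%N ->
  insert_cum j c t i = cum t i.
Proof. by rewrite /insert_cum => ->. Qed.

Lemma insert_cum_eq n (j : 'I_n.+1) c (t : 'rV[R]_n.+1) : insert_cum j c t j.+1 = c.
Proof. by rewrite /insert_cum ltnn eqxx. Qed.

Lemma insert_cum_gt n (j : 'I_n.+1) c (t : 'rV[R]_n.+1) i : (j < i)%N ->
  insert_cum j c t i.+1 = cum t i.
Proof. by move=> ji; rewrite /insert_cum leqNgt ltnW//= eqSS gtn_eqF. Qed.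

Lemma cum_row_insert n (j : 'I_n.+1) c (t : 'rV[R]_n.+1) i : (i <= n.+2)%N ->
  cum (row_insert j c t) i = insert_cum j c t i.
Proof. by move=> iN; rewrite cum_row_cum// (insert_cum_le _ _ (leq0n j)) cum0 subr0. Qed.

Lemma simplex_row_insert n (j : 'I_n.+1) c (t : 'rV[R]_n.+1) : simplex R n t ->
  cum t j <= c <= cum t j.+1 -> simplex R n.+1 (row_insert j c t).
Proof.
move=> st /andP[jc cj]; apply: simplex_row_cum => [||i _].
- by rewrite insert_cum_le// cum0.
- by rewrite insert_cum_gt ?cum1.
case: (ltngtP i j) => [ij|ji|->]; last by rewrite insert_cum_le// insert_cum_eq.
  by rewrite !insert_cum_le ?cum_le// ltnW.
rewrite (insert_cum_gt c t ji); move: ji; rewrite leq_eqVlt => /orP[/eqP <-|].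
  by rewrite insert_cum_eq.
by case: i => // i ji; rewrite insert_cum_gt// cum_le.
Qed.

(** [codegeneracy j] merges the blocks [j] and [j.+1], so it forgets exactly the inserted cut. *)
Lemma push_row_insert n (j : 'I_n.+1) c (t : 'rV[R]_n.+1) :
  push_row (codegeneracy j) (row_insert j c t) = t.
Proof.
apply: eq_cum => k kn; case: (leqP k j) => [kj|jk].
  rewrite (@cum_push _ _ _ _ _ _ k) ?cum_row_insert ?insert_cum_le//; first exact: leqW.
  move=> i /=; case: (ltnP j i) => ji; last by rewrite subn0.
  rewrite subn1 [RHS]ltnNge (leq_trans kj (ltnW ji)) ltnNge -ltnS prednK.
    by rewrite (leq_ltn_trans kj ji).
  exact: leq_ltn_trans ji.
rewrite (@cum_push _ _ _ _ _ _ k.+1) ?cum_row_insert ?insert_cum_gt//.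
move=> i /=; case: (ltnP j i) => ji.
  by rewrite subn1 -ltnS prednK// (leq_ltn_trans _ ji).
by rewrite subn0 (leq_ltn_trans ji jk) ltnS (leq_trans ji (ltnW jk)).
Qed.

Lemma cuts_row_insert n (j : 'I_n.+1) c (t : 'rV[R]_n.+1) : simplex R n t ->
  cum t j <= c <= cum t j.+1 -> cuts (row_insert j c t) = cuts t `|` [set c].
Proof.
move=> st cj; have si := simplex_row_insert st cj.
apply/seteqP; split=> [_ [i _ <-]|].
  case: (leqP i n.+2) => iN; last by left; exists n.+1; rewrite // !cum1// ltnW.
  rewrite cum_row_insert// /insert_cum; case: ifP => _; first by left; exists i.
  by case: ifP => _; [right|left; exists i.-1].
rewrite subUset; split; first by rewrite -{1}(push_row_insert j c t); exact: cuts_push_sub.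
by move=> _ ->; exists j.+1; rewrite // cum_row_insert ?insert_cum_eq// ltnW// ltnS.
Qed.

Lemma cum_bracket n (t : 'rV[R]_n.+1) c : simplex R n t -> 0 <= c <= 1 ->
  exists j : 'I_n.+1, cum t j <= c <= cum t j.+1.
Proof.
move=> st /andP[c0 c1].
have cP : exists j, c <= cum t j.+1 by exists n; rewrite cum1.
have [j cj jmin] := ex_minnP cP.
have jn : (j < n.+1)%N by rewrite ltnS jmin// cum1.
exists (Ordinal jn); rewrite cj andbT /=.
case: j {cj jn} jmin => [|j] jmin; first by rewrite cum0.
by rewrite leNgt; apply/negP => /ltW/jmin; rewrite ltnn.
Qed.

Variable K : simplicial_set.
Implicit Types (xi : realisation R K) (a b : thick_realisation R K).

(* A reparametrisation of [0, 1] moves the cuts, hence acts on both realisations. *)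
Definition thin_act (h : R -> R) xi : realisation R K :=
  let p : cell_points R K := repr (xi : coend R K in_Delta) in
  thin ((projT2 p).1 : K (projT1 p)) (row_act h (\val (projT2 p).2)).

Definition thick_act (h : R -> R) a : thick_realisation R K :=
  let p : cell_points R K := repr (a : coend R K in_Upsilon) in
  thick ((projT2 p).1 : K (projT1 p)) (row_act h (\val (projT2 p).2)).

Lemma thin_actE h n (x : K n) t : reparametrisation h -> simplex R n t ->
  thin_act h (thin x t) = thin x (row_act h t).
Proof.
move=> hr st; rewrite /thin_act.
have : thin_class (repr (thin x t : coend R K in_Delta)) = thin x t by exact: reprK.
case: (repr _) => m [y u] /=; rewrite -[u]to_simplex_val => E; rewrite to_simplex_val.
apply: (@thin_invariant _ _ _ (fun n (x : K n) t => thin x (row_act h t)) _ _ _ y x) => //.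
- move=> k l f z v sv; rewrite -push_row_act -?thin_glue//; last by case: hr.
  exact: simplex_row_act.
- exact: val_simplex.
Qed.

Lemma thick_actE h n (x : K n) t : reparametrisation h -> simplex R n t ->
  thick_act h (thick x t) = thick x (row_act h t).
Proof.
move=> hr st; rewrite /thick_act.
have : thick_class (repr (thick x t : coend R K in_Upsilon)) = thick x t by exact: reprK.
case: (repr _) => m [y u] /=; rewrite -[u]to_simplex_val => E; rewrite to_simplex_val.
apply: (@thick_invariant _ _ _ (fun n (x : K n) t => thick x (row_act h t)) _ _ _ y x) => //.
- move=> k l f z v f_inj sv; rewrite -push_row_act -?thick_glue//; last by case: hr.
  exact: simplex_row_act.
- exact: val_simplex.
Qed.

Lemma thick_proj_act h a : reparametrisation h ->
  thick_proj (thick_act h a) = thin_act h (thick_proj a).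
Proof.
move=> hr; have [n [x [t [st ->]]]] := thickP a.
by rewrite thick_actE// !thick_proj_thick thin_actE.
Qed.

Lemma thick_cuts_fixed a : thick_cuts a 0 /\ thick_cuts a 1.
Proof.
by have [n [x [t [st ->]]]] := thickP a; rewrite thick_cutsE//; exact: cuts_fixed.
Qed.

(** For fixed [x] and [j] the cell on the right is fixed and only the row moves, as required in
    [piecewise_insert]. *)
Lemma thick_insert n (x : K n) t (j : 'I_n.+1) c b : simplex R n t ->
  cum t j <= c <= cum t j.+1 -> thick_proj b = thin x t ->
  thick_cuts b = cuts t `|` [set c] ->
  b = thick (cell_map (codegeneracy j) x) (row_insert j c t).
Proof.
move=> st cj bx bt; have si := simplex_row_insert st cj.
apply: thick_inj; first by rewrite thick_proj_thick thin_glue// push_row_insert.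
by rewrite thick_cutsE// cuts_row_insert.
Qed.

Lemma thick_cut_exists a c : 0 <= c <= 1 -> exists b,
  thick_proj b = thick_proj a /\ thick_cuts b = thick_cuts a `|` [set c].
Proof.
move=> c01; have [n [x [t [st ->]]]] := thickP a.
have [j cj] := cum_bracket st c01; have si := simplex_row_insert st cj.
exists (thick (cell_map (codegeneracy j) x) (row_insert j c t)).
by rewrite !thick_proj_thick thin_glue// push_row_insert !thick_cutsE// cuts_row_insert.
Qed.

(* Scaling the added cuts by [l] from 0 to 1 is a path from [a] to the common refinement. *)
Definition is_join a (l : R) b c := thick_proj c = thick_proj a /\
  thick_cuts c = thick_cuts a `|` *%R l @` thick_cuts b.

(** The indices are restricted to a finite range so that the cuts can be inserted one after the
    other. *)
Lemma image_cuts n (t : 'rV[R]_n.+1) l : simplex R n t ->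
  *%R l @` cuts t = [set l * cum t j | j in `I_n.+2].
Proof.
move=> st; apply/seteqP; split=> [_ [_ [j _ <-] <-]|_ [j _ <-]]; last first.
  by exists (cum t j) => //; exists j.
case: (leqP j n.+1) => jn; first by exists j.
by exists n.+1 => //=; rewrite !cum1// ltnW.
Qed.

Lemma image_II_recr (f : nat -> R) k : [set f j | j in `I_k.+1] =
  [set f j | j in `I_k] `|` [set f k].
Proof. by rewrite IIS image_setU image_set1. Qed.

Lemma partial_join_exists a n (t : 'rV[R]_n.+1) l k : simplex R n t -> 0 <= l <= 1 ->
  exists b, thick_proj b = thick_proj a /\
    thick_cuts b = thick_cuts a `|` [set l * cum t j | j in `I_k].
Proof.
move=> st /andP[l0 l1]; elim: k => [|k [b [ba bE]]].
  by exists a; rewrite II0 image_set0 setU0.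
have /andP[? ?] := cum_itv k st.
have [|d [dc dE]] := thick_cut_exists b (c := l * cum t k).
  by rewrite mulr_ge0//= mulr_ile1.
by exists d; rewrite dc dE bE -setUA -image_II_recr.
Qed.

Lemma is_join_exists a l b : 0 <= l <= 1 -> exists c, is_join a l b c.
Proof.
move=> l01; have [n [x [t [st ->]]]] := thickP b.
have [c [ca cE]] := partial_join_exists a n.+2 st l01.
by exists c; split=> //; rewrite thick_cutsE// image_cuts.
Qed.

(** For [0 <= l <= 1] a join exists and, by [thick_inj], is unique. *)
Definition join a l b := xget a (is_join a l b).

Lemma joinP a l b : 0 <= l <= 1 -> is_join a l b (join a l b).
Proof. by move=> /(is_join_exists a b)[c ?]; apply: xgetPex; exists c. Qed.

Lemma is_join_unique a l b c c' : is_join a l b c -> is_join a l b c' -> c = c'.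
Proof. by move=> [pc cc] [pc' cc']; apply: thick_inj; rewrite ?pc ?pc' ?cc ?cc'. Qed.

(** Without scaling, the union of the cuts is symmetric. This matches formulas in which the two
    points have exchanged roles. *)
Lemma is_join_sym a b c : thick_proj a = thick_proj b -> is_join a 1 b c -> is_join b 1 a c.
Proof.
have mul1 (A : set R) : *%R 1 @` A = A.
  by apply/seteqP; split=> [_ [y Ay <-]|y Ay]; [|exists y]; rewrite ?mul1r.
by move=> ab [pc cc]; split; rewrite ?pc// cc !mul1 setUC.
Qed.

(** Scaled by 0, all cuts become 0, which is already a cut of [a]. *)
Lemma join0 a b : join a 0 b = a.
Proof.
apply: (@is_join_unique a 0 b); first by apply: joinP; rewrite lexx ler01.
split=> //; apply/seteqP; split=> [|c [//|[x _ <-]]]; first exact: subsetUl.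
by rewrite mul0r; case: (thick_cuts_fixed a).
Qed.

End refinement.

(** * Squeezing a simplex onto its boundary *)

Section squeezing.
Variable R : realType.

Definition clamp (l y : R) : R := Num.max 0 (Num.min l y).

Lemma clamp_le l y y' : y <= y' -> clamp l y <= clamp l y'.
Proof.
move=> yy'; rewrite /clamp ge_max le_max lexx/= le_max; apply/orP; right.
by rewrite le_min !ge_min lexx yy' orbT.
Qed.

Lemma clamp_low l y : 0 <= l -> y <= 0 -> clamp l y = 0.
Proof. by move=> l0 y0; rewrite /clamp max_l// ge_min y0 orbT. Qed.

Lemma clamp_high l y : 0 <= l -> l <= y -> clamp l y = l.
Proof. by move=> l0 ly; rewrite /clamp min_l// max_r. Qed.

Lemma clampE l y : 0 <= l -> clamp l y = Num.min y l - Num.min y 0.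
Proof.
move=> l0; rewrite /clamp; case: (leP l y) => ly; case: (leP y 0) => y0;
  [case: (leP 0 l)|case: (leP 0 l)|case: (leP 0 y)|case: (leP 0 y)]; lra.
Qed.

(* The length of what is left of [0, y] when an initial segment of length [m] is removed
   from every block of [t]. *)
Definition cut_length n (t : 'rV[R]_n.+1) (m y : R) : R :=
  \sum_(j < n.+1) clamp (t ord0 j - m) (y - cum t j - m).

Definition min_coord n (t : 'rV[R]_n.+1) : R := t ord0 [arg min_(j < ord0) t ord0 j]%O.

(** For [m] the least coordinate this is the radial projection from the barycentre onto the
    boundary: [t] is the convex combination of the barycentre, with weight [n.+1%:R * m], and
    [squeeze t m]. *)
Definition squeeze n (t : 'rV[R]_n.+1) (m : R) : 'rV[R]_n.+1 :=
  \row_j ((t ord0 j - m) / (1 - n.+1%:R * m)).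

Lemma min_coord_le n (t : 'rV[R]_n.+1) j : min_coord t <= t ord0 j.
Proof. by rewrite /min_coord; case: arg_minP => // i _; exact. Qed.

Lemma min_coord_attained n (t : 'rV[R]_n.+1) : exists i, min_coord t = t ord0 i.
Proof. by eexists; reflexivity. Qed.

Lemma min_coordE n (t : 'rV[R]_n.+1) i : (forall j, t ord0 i <= t ord0 j) ->
  min_coord t = t ord0 i.
Proof. by move=> ti; apply/eqP; rewrite eq_le min_coord_le ti. Qed.

Lemma min_coord_ge0 n (t : 'rV[R]_n.+1) : simplex R n t -> 0 <= min_coord t.
Proof. by case=> t0 _; exact: t0. Qed.

Section fixed_simplex.
Variables (n : nat) (t : 'rV[R]_n.+1) (m : R).
Hypotheses (st : simplex R n t) (m0 : 0 <= m) (mt : forall j, m <= t ord0 j).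

Lemma cut_length_le y y' : y <= y' -> cut_length t m y <= cut_length t m y'.
Proof. by move=> yy'; apply: ler_sum => j _; rewrite clamp_le// !lerD2r. Qed.

(** Each of the [i] blocks before the cut loses [m], and the later blocks contribute nothing. *)
Lemma cut_length_cum i : (i <= n.+1)%N -> cut_length t m (cum t i) = cum t i - i%:R * m.
Proof.
move=> iN; rewrite /cut_length (bigID (fun j : 'I_n.+1 => (j < i)%N))/=.
rewrite [X in _ + X]big1 => [|j]; last first.
  rewrite -leqNgt => ij; apply: clamp_low; first by rewrite subr_ge0.
  have : cum t i <= cum t j by exact: cum_le.
  by move: m0; lra.
rewrite addr0 (eq_bigr (fun j => t ord0 j - m)) => [|j ji]; last first.
  apply: clamp_high; first by rewrite subr_ge0.
  have : cum t j.+1 <= cum t i by exact: cum_le.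
  by rewrite cumS; lra.
rewrite sumrB; congr (_ - _); rewrite sumr_const mulr_natl; congr (_ *+ _).
rewrite -[RHS](card_ord i) -(card_imset _ (f := widen_ord iN)); last first.
  by move=> j k /(congr1 val)/= /ord_inj.
apply: eq_card => j; rewrite unfold_in; apply/idP/imsetP => [ji|[k _ ->]]; last exact: (ltn_ord k).
by exists (Ordinal ji) => //; exact/val_inj.
Qed.

Lemma cut_length0 : cut_length t m 0 = 0.
Proof. by have := cut_length_cum (leq0n _); rewrite cum0 mul0r subr0. Qed.

Lemma cut_length1 : cut_length t m 1 = 1 - n.+1%:R * m.
Proof. by have := cut_length_cum (leqnn _); rewrite cum1. Qed.

Hypothesis m1 : n.+1%:R * m < 1.

Lemma simplex_squeeze : simplex R n (squeeze t m).
Proof.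
split=> [j|]; first by rewrite mxE divr_ge0 ?subr_ge0// ltW.
rewrite (eq_bigr (fun j => (t ord0 j - m) / (1 - n.+1%:R * m))) => [|j _]; last by rewrite mxE.
rewrite -mulr_suml sumrB; case: st => _ ->; rewrite sumr_const card_ord mulr_natl divff//.
by rewrite -mulr_natl subr_eq0 gt_eqF.
Qed.

(** On the cuts, squeezing is thus a reparametrisation of [0, 1], along which the warp of a boundary
    point can be pulled back to [t]. *)
Lemma cum_squeeze i : (i <= n.+1)%N ->
  cum (squeeze t m) i = cut_length t m (cum t i) / (1 - n.+1%:R * m).
Proof.
move=> iN; rewrite cut_length_cum//.
elim: i iN => [|i IHi] iN; first by rewrite !cum0 mul0r subr0 mul0r.
rewrite !(cumS _ (Ordinal iN)) IHi 1?ltnW// mxE -mulrDl; congr (_ / _).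
by rewrite -natr1 mulrDl mul1r; lra.
Qed.

Lemma stretch_itv y : 0 <= y <= 1 -> 0 <= cut_length t m y / (1 - n.+1%:R * m) <= 1.
Proof.
move=> /andP[y0 y1]; have r0 : 0 < 1 - n.+1%:R * m by rewrite subr_gt0.
have := cut_length_le y0; rewrite cut_length0 => g0.
have := cut_length_le y1; rewrite cut_length1 => g1.
apply/andP; split; first by apply: divr_ge0 => //; exact: ltW.
by rewrite ler_pdivrMr// mul1r.
Qed.

Lemma reparametrisation_stretch h a : 0 <= a <= 1 -> reparametrisation h ->
  reparametrisation (fun y => (1 - a) * h (cut_length t m y / (1 - n.+1%:R * m)) + a * y).
Proof.
move=> /andP[a0 a1] [h0 h1 hle]; have r0 : 0 < 1 - n.+1%:R * m by rewrite subr_gt0.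
split=> [||x y x0 xy y1].
- by rewrite cut_length0 mul0r h0 !mulr0 addr0.
- by rewrite cut_length1 divff ?gt_eqF// h1; lra.
have /andP[? _] := @stretch_itv x ltac:(by rewrite x0 (le_trans xy)).
have /andP[_ ?] := @stretch_itv y ltac:(by rewrite y1 (le_trans x0)).
rewrite lerD// ler_wpM2l ?subr_ge0// hle// ler_pM2r ?invr_gt0//.
exact: cut_length_le.
Qed.

End fixed_simplex.

Lemma cut_length_id n (t : 'rV[R]_n.+1) y : simplex R n t -> 0 <= y <= 1 ->
  cut_length t 0 y = y.
Proof.
move=> st /andP[y0 y1].
(* The first [j] blocks account for the part of [0, y] below the j-th cut. *)
have E j : (j <= n.+1)%N -> \sum_(i < n.+1 | (i < j)%N) clamp (t ord0 i - 0) (y - cum t i - 0) =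
    Num.min y (cum t j).
  elim: j => [|j IHj] jn; first by rewrite big1// cum0 min_r.
  rewrite (bigD1 (Ordinal jn))//= (eq_bigl (fun i : 'I_n.+1 => (i < j)%N)); last first.
    by move=> i; rewrite ltnS ltn_neqAle andbC.
  rewrite IHj 1?ltnW// (cumS t (Ordinal jn))/= !subr0 clampE; last by case: st.
  move: (t ord0 (Ordinal jn)) (cum t j) (st.1 (Ordinal jn)) => u v u0.
  by case: (leP y v); case: (leP y (v + u)); case: (leP (y - v) u); case: (leP (y - v) 0); lra.
have := E n.+1 (leqnn _); rewrite cum1// min_l// => sumE.
by rewrite -[RHS]sumE; apply: eq_bigl => i; rewrite ltn_ord.
Qed.

Lemma squeeze0 n (t : 'rV[R]_n.+1) : squeeze t 0 = t.
Proof. by apply/rowP => j; rewrite mxE mulr0 !subr0 divr1. Qed.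

End squeezing.

(** * The lift *)

Section lifting.
Variables (R : realType) (K : simplicial_set).
Local Notation state := ((R -> R) * thick_realisation R K)%type.

(* With [r] the distance from the boundary, normalised to be 1 at the barycentre: the
   lift of the boundary point is continued radially while the cuts of [h t] are
   grown from 0 ([r <= 1/4]); then the cuts of the boundary lift are shrunk into 0
   ([1/4 <= r <= 1/2]), and from there on the lift is the cell itself. *)
Definition step n (z : K n) (t : 'rV[R]_n.+1) (p : state) : state :=
  let m := min_coord t in
  let r := n.+1%:R * m in
  let a := Num.max 0 (4 * r - 1) in
  let h y := if 2^-1 <= r then y
             else (1 - a) * p.1 (cut_length t m y / (1 - r)) + a * y in
  (h, if r <= 4^-1 then join p.2 (4 * r) (thick z (row_act h t))
      else if r <= 2^-1 then join (thick z (row_act h t)) (2 - 4 * r) p.2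
      else thick z t).

Definition boundary_point n (z : K n) (t : 'rV[R]_n.+1) : realisation R K :=
  thin z (squeeze t (min_coord t)).

(** This covers the barycentre, where [r = 1], so that [squeeze] divides by 0 and [boundary_dim]
    gives no bound for the recursion. *)
Lemma step_center n (z : K n) (t : 'rV[R]_n.+1) p q :
  2^-1 < n.+1%:R * min_coord t -> step z t p = step z t q.
Proof.
move=> r; rewrite /step (ltW r) !leNgt r/= (lt_trans _ r)//.
by lra.
Qed.

Lemma normal_form_choice (xi : realisation R K) :
  exists p : {d & (K d * 'rV[R]_d.+1)%type},
  [/\ nondegenerate_cell (projT2 p).1, simplex R (projT1 p) (projT2 p).2,
      interior_point (projT2 p).2 & xi = thin (projT2 p).1 (projT2 p).2].
Proof.
have [n [x [t [st ->]]]] := thinP xi; have [d [z [s nf]]] := normal_form_exists x st.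
by exists (existT _ d (z, s)); exact: normal_form_interior nf.
Qed.

Definition nf xi := projT1 (cid (normal_form_choice xi)).

Definition nf_dim xi := projT1 (nf xi).

Lemma nfP xi : [/\ nondegenerate_cell (projT2 (nf xi)).1,
  simplex R (nf_dim xi) (projT2 (nf xi)).2,
  interior_point (projT2 (nf xi)).2 & xi = thin (projT2 (nf xi)).1 (projT2 (nf xi)).2].
Proof. exact: projT2 (cid (normal_form_choice xi)). Qed.

Lemma nfE d (z : K d) (s : 'rV[R]_d.+1) : nondegenerate_cell z -> simplex R d s ->
  interior_point s -> nf (thin z s) = existT _ d (z, s).
Proof.
move=> nd ss s0; have [nd' ss' s0' E] := nfP (thin z s).
have := thin_interior_inj nd' ss' s0' nd ss s0 (esym E).
by rewrite /nf_dim; case: (nf _) {nd' ss' s0' E} => d' [z' s'].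
Qed.

Lemma nf_dim_le n (x : K n) t : simplex R n t -> (nf_dim (thin x t) <= n)%N.
Proof.
move=> st; have [d [z [s nf]]] := normal_form_exists x st.
have [nd ss s0 ->] := normal_form_interior nf.
by rewrite /nf_dim nfE//=; exact: normal_form_dim nf.
Qed.

Lemma boundary_face n (z : K n.+1) (t : 'rV[R]_n.+2) i : simplex R n.+1 t ->
  t ord0 i = 0 -> thin z t = thin (cell_map (coface i) z) (face_row i t).
Proof.
by move=> st ti; rewrite thin_glue ?push_face_row//; exact: simplex_face_row.
Qed.

(** The least coordinate is squeezed to 0, which puts the point on a face. In dimension 0 the second
    hypothesis fails, the only coordinate being 1. *)
Lemma boundary_dim n (z : K n) t : simplex R n t -> n.+1%:R * min_coord t < 1 ->
  (nf_dim (boundary_point z t) < n)%N.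
Proof.
case: n z t => [|n] z t st r1.
  have : min_coord t = 1.
    by case: st => _; rewrite /min_coord big_ord1; case: arg_minP => // i _ _; rewrite (ord1 i).
  by move=> m1; rewrite m1 mulr1 ltxx in r1.
have sb := simplex_squeeze st (min_coord_le t) r1.
have [i ti] := min_coord_attained t.
have bi : squeeze t (min_coord t) ord0 i = 0 by rewrite mxE ti subrr mul0r.
rewrite /boundary_point (boundary_face z sb bi) ltnS nf_dim_le//.
exact: simplex_face_row.
Qed.

(* The boundary point has a normal form of smaller dimension, so that a fuel exceeding the
   dimension of [xi] is enough (flow_stable). *)
Fixpoint flow (k : nat) (xi : realisation R K) : state :=
  let p := nf xi in
  if k is k.+1 then step (projT2 p).1 (projT2 p).2
    (flow k (boundary_point (projT2 p).1 (projT2 p).2))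
  else (id, thick (projT2 p).1 (projT2 p).2).

Lemma flow_stable k l xi : (nf_dim xi < k)%N -> (nf_dim xi < l)%N -> flow k xi = flow l xi.
Proof.
elim: k l xi => [//|k IHk] [//|l] xi xik xil /=.
have [_ st _ _] := nfP xi; move: (projT2 (nf xi)).2 (projT2 (nf xi)).1 st => t z st.
(* Deep inside the cell both values are given by [step_center]; elsewhere the dimension drops. *)
have [r|r] := ltP 2^-1 ((nf_dim xi).+1%:R * min_coord t); first exact: step_center.
have dim := @boundary_dim _ z t st ltac:(by apply: le_lt_trans r _; lra).
by rewrite (IHk l)//; exact: leq_trans dim _.
Qed.

(** This is the reparametrisation h_xi, and [thick_lift xi] is s(xi). *)
Definition warp xi := (flow (nf_dim xi).+1 xi).1.
Definition thick_lift xi := (flow (nf_dim xi).+1 xi).2.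

Lemma flow_interior n (z : K n) t : nondegenerate_cell z -> simplex R n t ->
  interior_point t -> let xi := boundary_point z t in
  (warp (thin z t), thick_lift (thin z t)) = step z t (warp xi, thick_lift xi).
Proof.
move=> nd st t0 /=; rewrite /warp /thick_lift -!surjective_pairing.
have -> : flow (nf_dim (thin z t)).+1 (thin z t) = step z t (flow n (boundary_point z t)).
  by rewrite /nf_dim /= nfE.
have [r|r] := ltP 2^-1 (n.+1%:R * min_coord t); first exact: step_center.
congr step; apply: flow_stable => //.
by apply: boundary_dim => //; apply: le_lt_trans r _; lra.
Qed.

Lemma step_reparametrisation n (z : K n) t p : simplex R n t ->
  (n.+1%:R * min_coord t < 2^-1 -> reparametrisation p.1) ->
  reparametrisation (step z t p).1.
Proof.
move=> st hp; rewrite /step /=; case: leP => r; first by split.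
apply: reparametrisation_stretch => //; [exact: min_coord_ge0|exact: min_coord_le|lra| |exact: hp].
by rewrite le_max lexx/= ge_max ler01/=; lra.
Qed.

Lemma row_act_id n (t : 'rV[R]_n.+1) h : (forall y, 0 <= y <= 1 -> h y = y) ->
  simplex R n t -> row_act h t = t.
Proof.
move=> hid st; apply: eq_cum => j _; rewrite cum_row_act.
  by rewrite hid//; exact: cum_itv.
by rewrite hid// lexx ler01.
Qed.

Lemma eq_row_act n (t : 'rV[R]_n.+1) h h' : (forall y, 0 <= y <= 1 -> h y = h' y) ->
  simplex R n t -> row_act h t = row_act h' t.
Proof.
by move=> hh' st; apply/rowP => j; rewrite !mxE /= !hh'//; exact: cum_itv.
Qed.

Lemma row_act_squeeze n (t : 'rV[R]_n.+1) m h : simplex R n t -> 0 <= m ->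
  (forall j, m <= t ord0 j) -> n.+1%:R * m < 1 -> h 0 = 0 ->
  row_act h (squeeze t m) = row_act (fun y => h (cut_length t m y / (1 - n.+1%:R * m))) t.
Proof.
move=> st m0 mt m1 h0; apply: eq_cum => j jn.
by rewrite cum_row_act// cum_squeeze// cum_row_act// cut_length0// mul0r.
Qed.

(** Induction on the dimension of the normal form. A join lies over the base point of its first
    argument. Outside the inner collar this is [t] moved by the warp; in the inner collar it is the
    base point of the lift of [zeta], and the squeezing has to be undone. *)
Lemma warp_spec xi : reparametrisation (warp xi) /\
  thick_proj (thick_lift xi) = thin_act (warp xi) xi.
Proof.
move: {2}(nf_dim xi) (leqnn (nf_dim xi)) => k; elim/ltn_ind: k xi => k IHk xi.
have [[n [z t]] /= [nd st t0 ->]] := normal_form_choice xi.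
rewrite {1}/nf_dim nfE//= => nk; have /= := flow_interior nd st t0.
set zeta := boundary_point z t; set r := n.+1%:R * min_coord t.
have IH : r <= 2^-1 -> reparametrisation (warp zeta) /\
    thick_proj (thick_lift zeta) = thin_act (warp zeta) zeta.
  move=> r2; apply: (IHk (nf_dim zeta)) => //; apply: leq_trans nk.
  by apply: boundary_dim => //; rewrite -/r; lra.
have m0 := min_coord_ge0 st; have mle := min_coord_le t.
have r0 : 0 <= r by rewrite mulr_ge0.
set q := step _ _ _ => E.
have -> : warp (thin z t) = q.1 by rewrite -E.
have -> : thick_lift (thin z t) = q.2 by rewrite -E.
have qr : reparametrisation q.1.
  by apply: step_reparametrisation => // /ltW/IH[].
split=> //; rewrite thin_actE//.
rewrite {1}/q /step -/r /=; case: (leP r 4^-1) => r4.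
  have r1 : r < 1 by lra.
  have [|-> _] := @joinP _ _ (thick_lift zeta) (4 * r) (thick z (row_act q.1 t)).
    by rewrite mulr_ge0//=; lra.
  have [|hr ->] := IH; first by lra.
  rewrite thin_actE//; last exact: simplex_squeeze.
  rewrite row_act_squeeze//; last by case: hr.
  (* In the inner collar the weight of the identity is 0, so that [q.1] is the warp of [zeta] after
     the stretching. *)
  congr thin; apply: eq_row_act => // y _; rewrite /q /step -/r /= leNgt.
  have -> : r < 2^-1 by lra.
  have -> : Num.max 0 (4 * r - 1) = 0 by apply: max_l; lra.
  by rewrite subr0 mul1r mul0r addr0.
case: (leP r 2^-1) => r2.
  have [|-> _] := @joinP _ _ (thick z (row_act q.1 t)) (2 - 4 * r) (thick_lift zeta).
    by apply/andP; split; lra.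
  exact: thick_proj_thick.
rewrite thick_proj_thick (row_act_id (h := q.1))// => y _.
by rewrite /q /step -/r /= (ltW r2).
Qed.

(* [flow] unfolds to [step] by definition in the interior of [z]. On the boundary [step] is
   the identity, because squeezing does not move [t]. *)
Lemma flowE n (z : K n) t : nondegenerate_cell z -> simplex R n t ->
  let xi := boundary_point z t in
  thick_lift (thin z t) = (step z t (warp xi, thick_lift xi)).2 /\
  forall y, 0 <= y <= 1 -> warp (thin z t) y = (step z t (warp xi, thick_lift xi)).1 y.
Proof.
move=> nd st xi; have [t0|] := pselect (interior_point t).
  by rewrite -(flow_interior nd st t0).
move=> /existsNP[j /negP]; rewrite -leNgt => tj.
have m0 : min_coord t = 0.
  by apply/eqP; rewrite eq_le min_coord_ge0// andbT (le_trans (min_coord_le _ j)).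
have half : ((2^-1 : R) <= 0) = false by lra.
have quarter : (0 <= (4^-1 : R)) = true by lra.
have max0 : Num.max 0 (- 1) = 0 :> R by apply: max_l; lra.
rewrite /xi /boundary_point /step m0 squeeze0 !mulr0 sub0r max0 !subr0/= half quarter.
rewrite join0; split=> // y y01.
by rewrite mul1r mul0r addr0 divr1 cut_length_id.
Qed.

End lifting.

(** * Piecewise cellular maps *)

Section continuity.
Variable R : realType.

Section real_functions.
Variable T : topologicalType.
Implicit Types f g : T -> R.

Lemma continuous_addf f g : continuous f -> continuous g -> continuous (fun p => f p + g p).
Proof. by move=> fc gc p; apply: cvgD; [exact: fc|exact: gc]. Qed.

Lemma continuous_subf f g : continuous f -> continuous g -> continuous (fun p => f p - g p).
Proof. by move=> fc gc p; apply: cvgB; [exact: fc|exact: gc]. Qed.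

Lemma continuous_mulf f g : continuous f -> continuous g -> continuous (fun p => f p * g p).
Proof. by move=> fc gc p; apply: cvgM; [exact: fc|exact: gc]. Qed.

Lemma continuous_invf f : continuous f -> (forall p, f p != 0) -> continuous (fun p => (f p)^-1).
Proof. by move=> fc f0 p; apply: cvgV; [exact: f0|exact: fc]. Qed.

Lemma continuous_maxf f g : continuous f -> continuous g ->
  continuous (fun p => Num.max (f p) (g p)).
Proof. by move=> fc gc p; apply: continuous_max; [exact: fc|exact: gc]. Qed.

Lemma continuous_minf f g : continuous f -> continuous g ->
  continuous (fun p => Num.min (f p) (g p)).
Proof. by move=> fc gc p; apply: continuous_min; [exact: fc|exact: gc]. Qed.

Lemma continuous_sumf I (r : seq I) (P : pred I) (f : I -> T -> R) :
  (forall i, continuous (f i)) -> continuous (fun p => \sum_(i <- r | P i) f i p).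
Proof.
move=> fc; elim: r => [|i r IHr].
  under eq_fun do rewrite big_nil.
  exact: cst_continuous.
under eq_fun do rewrite big_cons.
by case: (P i) => //; apply: continuous_addf => //; exact: fc.
Qed.

End real_functions.

Section rows.
Variable T : topologicalType.

Lemma continuous_row n (w : T -> 'rV[R]_n.+1) :
  (forall j, continuous (fun p => w p ord0 j)) -> continuous w.
Proof.
move=> wc p A [B Bw BA]; have : \forall q \near p, forall j, B ord0 j (w q ord0 j).
  by apply: filter_forall => j; apply: wc; exact: Bw.
by apply: filterS => q Bq; apply: BA => i j; rewrite (ord1 i).
Qed.

Lemma continuous_coord n (w : T -> 'rV[R]_n.+1) j :
  continuous w -> continuous (fun p => w p ord0 j).
Proof.
move=> wc p; apply: (@continuous_comp _ _ _ w (fun t : 'rV[R]_n.+1 => t ord0 j)).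
  exact: wc.
exact: coord_continuous.
Qed.

Lemma continuous_cum n (w : T -> 'rV[R]_n.+1) j :
  continuous w -> continuous (fun p => cum (w p) j).
Proof. by move=> wc; apply: continuous_sumf => i; exact: continuous_coord. Qed.

Lemma continuous_row_cum n (C : T -> nat -> R) :
  (forall j, (j <= n.+1)%N -> continuous (C ^~ j)) -> continuous (fun p => row_cum n (C p)).
Proof.
move=> Cc; apply: continuous_row => j; under eq_fun do rewrite mxE.
by apply: continuous_subf; apply: Cc => //; exact: ltnW.
Qed.

Lemma continuous_push_row m n (f : delta_hom m n) (w : T -> 'rV[R]_m.+1) :
  continuous w -> continuous (fun p => push_row f (w p)).
Proof.
move=> wc; apply: continuous_row => j; under eq_fun do rewrite mxE.
by apply: continuous_sumf => i; exact: continuous_coord.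
Qed.

Lemma continuous_face_row n (j : 'I_n.+2) (w : T -> 'rV[R]_n.+2) :
  continuous w -> continuous (fun p => face_row j (w p)).
Proof.
move=> wc; apply: continuous_row => i; under eq_fun do rewrite mxE.
exact: continuous_coord.
Qed.

Lemma continuous_row_insert n (j : 'I_n.+1) (c : T -> R) (w : T -> 'rV[R]_n.+1) :
  continuous c -> continuous w -> continuous (fun p => row_insert j (c p) (w p)).
Proof.
move=> cc wc; apply: continuous_row_cum => i _; rewrite /insert_cum.
case: (i <= j)%N; first exact: continuous_cum.
by case: (i == j.+1); [exact: cc|exact: continuous_cum].
Qed.

Lemma continuous_cut_length n (w : T -> 'rV[R]_n.+1) (m y : T -> R) :
  continuous w -> continuous m -> continuous y ->
  continuous (fun p => cut_length (w p) (m p) (y p)).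
Proof.
move=> wc mc yc; apply: continuous_sumf => j.
apply: continuous_maxf; first exact: cst_continuous.
apply: continuous_minf; first by apply: continuous_subf => //; exact: continuous_coord.
by do 2![apply: continuous_subf => //]; exact: continuous_cum.
Qed.

End rows.

Lemma closed_within_le (T : topologicalType) (Q : set T) (a b : T -> R) : closed Q ->
  {within Q, continuous a} -> {within Q, continuous b} ->
  closed (Q `&` [set p | a p <= b p]).
Proof.
move=> Qc ac bc; have : closed ((fun p => b p - a p) @^-1` [set y : R | 0 <= y] : set (subspace Q)).
  apply: preimage_closed; last exact: closed_ge.
  by move=> p _; apply: continuousB; [exact: bc|exact: ac].
move=> /closed_subspaceP[V Vc VE]; rewrite setIC.
suff -> : [set p | a p <= b p] `&` Q = V `&` Q by exact: closedI.
by rewrite VE; congr (_ `&` _); apply/seteqP; split=> p /=; rewrite subr_ge0.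
Qed.

Lemma finite_cover_ind (T : Type) (C : set T -> Prop) n (A : 'I_n.+1 -> set T) :
  (forall A B, C A -> C B -> C (A `|` B)) -> (forall i, C (A i)) -> C (\bigcup_i A i).
Proof.
move=> CU; elim: n A => [|n IHn] A CA.
  suff -> : \bigcup_i A i = A ord0 by [].
  by apply/seteqP; split=> [p [i _]|p Ap]; [rewrite (ord1 i)|exists ord0].
rewrite (_ : \bigcup_i A i = A ord0 `|` \bigcup_i A (lift ord0 i)).
  by apply: CU => //; apply: IHn.
apply/seteqP; split=> [p [i _]|p [Ap|[i _ Ap]]]; [|by exists ord0|by exists (lift ord0 i)].
by case: (unliftP ord0 i) => [j|] ->; [right; exists j|left].
Qed.

Variable K : simplicial_set.

Lemma continuous_cell_point n (x : K n) :
  continuous (fun t : simplex R n => cell_point x t).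
Proof.
move=> t A [[B C] /= [Bx Ct] BCA]; apply: filterS Ct => u Cu.
by apply: BCA; split=> //=; exact: nbhs_singleton Bx.
Qed.

Lemma continuous_cell_within (P : topologicalType) (Q : set P) n (x : K n)
    (w : P -> 'rV[R]_n.+1) : {within Q, continuous w} ->
  (forall p, Q p -> simplex R n (w p)) ->
  {within Q, continuous (fun p => cell_point x (to_simplex (w p)))}.
Proof.
move=> wc ws.
(* The simplex has the initial topology for its inclusion into the rows, and on [Q] the default
   value of [to_simplex] does not occur. *)
have toc : continuous (fun p : subspace Q => to_simplex (w p)).
  apply: continuous_comp_initial; apply: subspace_eq_continuous wc => p /set_mem Qp.
  exact: (esym (to_simplexK (ws _ Qp))).
by move=> p; apply: continuous_comp; [exact: toc|exact: continuous_cell_point].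
Qed.

Lemma continuous_thick_within (P : topologicalType) (Q : set P) n (x : K n)
    (w : P -> 'rV[R]_n.+1) : {within Q, continuous w} ->
  (forall p, Q p -> simplex R n (w p)) -> {within Q, continuous (fun p => thick x (w p))}.
Proof.
move=> wc ws p; apply: (@continuous_comp (subspace Q) (cell_points R K) _
    (fun p => cell_point x (to_simplex (w p))) (@thick_class R K)).
  exact: continuous_cell_within.
by move: (cell_point _ _); exact: pi_continuous.
Qed.

Lemma continuous_thin_within (P : topologicalType) (Q : set P) n (x : K n)
    (w : P -> 'rV[R]_n.+1) : {within Q, continuous w} ->
  (forall p, Q p -> simplex R n (w p)) -> {within Q, continuous (fun p => thin x (w p))}.
Proof.
move=> wc ws p; apply: (@continuous_comp (subspace Q) (cell_points R K) _
    (fun p => cell_point x (to_simplex (w p))) (@thin_class R K)).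
  exact: continuous_cell_within.
by move: (cell_point _ _); exact: pi_continuous.
Qed.

(* A map into ||K|| given over finitely many closed pieces by fixed cells with
   continuously varying coordinates. *)
Inductive piecewise_cellular (P : topologicalType) :
    set P -> (P -> thick_realisation R K) -> Prop :=
| Cellular Q f n (x : K n) w of closed Q & {within Q, continuous w} &
    (forall p, Q p -> simplex R n (w p)) &
    (forall p, Q p -> f p = thick x (w p)) : piecewise_cellular Q f
| Pasting Q Q' f of piecewise_cellular Q f & piecewise_cellular Q' f :
    piecewise_cellular (Q `|` Q') f.

Section piecewise.
Variable P : topologicalType.
Implicit Types (Q : set P) (f g : P -> thick_realisation R K).

Lemma piecewise_closed Q f : piecewise_cellular Q f -> closed Q.
Proof. by elim=> // *; exact: closedU. Qed.

Lemma piecewise_continuous Q f : piecewise_cellular Q f -> {within Q, continuous f}.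
Proof.
elim=> {Q f} [Q f n x w Qc wc ws fE|Q Q' f fQ fc fQ' fc'].
  apply: (@subspace_eq_continuous _ Q _ (fun p => thick x (w p))).
    by move=> p /set_mem Qp; exact: (esym (fE p Qp)).
  exact: continuous_thick_within.
by apply: withinU_continuous => //; [exact: piecewise_closed fQ|exact: piecewise_closed fQ'].
Qed.

Lemma piecewiseW Q A f : closed A -> A `<=` Q -> piecewise_cellular Q f ->
  piecewise_cellular A f.
Proof.
move=> + + fQ; elim: fQ A => {Q f} [Q f n x w Qc wc ws fE A Ac AQ|Q Q' f fQ IH fQ' IH' A Ac AQ].
  apply: (@Cellular _ _ _ n x w) => // [|p /AQ/ws//|p /AQ/fE//].
  exact: continuous_subspaceW wc.
rewrite -(setIidl AQ) setIUr; apply: Pasting; [apply: IH|apply: IH'].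
- by apply: closedI => //; exact: piecewise_closed fQ.
- exact: subIsetr.
- by apply: closedI => //; exact: piecewise_closed fQ'.
- exact: subIsetr.
Qed.

Lemma eq_piecewise Q f g : (forall p, Q p -> f p = g p) -> piecewise_cellular Q f ->
  piecewise_cellular Q g.
Proof.
move=> + fQ; elim: fQ g => {Q f} [Q f n x w Qc wc ws fE g fg|Q Q' f _ IH _ IH' g fg].
  by apply: (@Cellular _ _ _ n x w) => // p Qp; rewrite -fg// fE.
by apply: Pasting; [apply: IH|apply: IH'] => p Qp; apply: fg; [left|right].
Qed.

Lemma piecewise_cover n Q (A : 'I_n.+1 -> set P) f :
  (forall i, piecewise_cellular (Q `&` A i) f) -> Q `<=` \bigcup_i A i ->
  piecewise_cellular Q f.
Proof.
move=> Af QA; have -> : Q = \bigcup_i (Q `&` A i).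
  by apply/seteqP; split=> [p Qp|p [i _ []//]]; have [i _ Ap] := QA _ Qp; exists i.
apply: (@finite_cover_ind P (fun Q => piecewise_cellular Q f) n (fun i => Q `&` A i)) => //.
by move=> A' B'; exact: Pasting.
Qed.

(** On a piece with a fixed cell, the sets where [c] lies between two given consecutive cuts are
    closed and finite in number. On each of them the new point stays in one degenerate cell. *)
Lemma piecewise_insert Q f (c : P -> R) : piecewise_cellular Q f -> {within Q, continuous c} ->
  (forall p, Q p -> 0 <= c p <= 1) -> forall g,
  (forall p, Q p -> thick_proj (g p) = thick_proj (f p) /\
     thick_cuts (g p) = thick_cuts (f p) `|` [set c p]) ->
  piecewise_cellular Q g.
Proof.
elim=> {Q f} [Q f n x w Qc wc ws fE cc c01 g gE|Q Q' f _ IH _ IH' cc c01 g gE]; last first.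
  apply: Pasting.
  - apply: IH => [|p Qp|p Qp]; [|by apply: c01; left|by apply: gE; left].
    by apply: continuous_subspaceW cc; exact: subsetUl.
  - apply: IH' => [|p Qp|p Qp]; [|by apply: c01; right|by apply: gE; right].
    by apply: continuous_subspaceW cc; exact: subsetUr.
apply: (@piecewise_cover n _ (fun j => [set p | cum (w p) j <= c p] `&`
  [set p | c p <= cum (w p) j.+1])) => [j|p Qp]; last first.
  have [j /andP[? ?]] := cum_bracket (ws _ Qp) (c01 _ Qp).
  by exists j.
apply: (@Cellular _ _ _ _ (cell_map (codegeneracy j) x) (fun p => row_insert j (c p) (w p))).
- rewrite setIA; apply: closed_within_le; last 2 first.
  + by apply: continuous_subspaceW cc; exact: subIsetl.
  + by apply: continuous_cum; apply: continuous_subspaceW wc; exact: subIsetl.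
  apply: closed_within_le => //; exact: continuous_cum.
- apply: continuous_row_insert.
  + by apply: continuous_subspaceW cc; exact: subIsetl.
  + by apply: continuous_subspaceW wc; exact: subIsetl.
- by move=> p [Qp [cj jc]]; apply: simplex_row_insert; [exact: ws|exact/andP].
- move=> p [Qp [cj jc]]; have [gp gc] := gE _ Qp.
  apply: thick_insert; [exact: ws|exact/andP| |].
  + by rewrite gp fE// thick_proj_thick.
  + by rewrite gc fE// thick_cutsE//; exact: ws.
Qed.

(** Over each piece of [g] there are finitely many cuts to add, depending continuously on the
    parameter; they are inserted one at a time. *)
Lemma piecewise_join Q f g (l : P -> R) : piecewise_cellular Q f -> piecewise_cellular Q g ->
  {within Q, continuous l} -> (forall p, Q p -> 0 <= l p <= 1) -> forall f',
  (forall p, Q p -> is_join (f p) (l p) (g p) (f' p)) -> piecewise_cellular Q f'.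
Proof.
move=> + gQ; elim: gQ => {Q g} [Q g n x w Qc wc ws gE|Q Q' g gQ IH gQ' IH'] fQ lc l01 f' f'E;
  last first.
  apply: Pasting.
  - apply: IH => [||p Qp|p Qp]; [| |by apply: l01; left|by apply: f'E; left].
    + by apply: piecewiseW fQ; [exact: piecewise_closed gQ|exact: subsetUl].
    + by apply: continuous_subspaceW lc; exact: subsetUl.
  - apply: IH' => [||p Qp|p Qp]; [| |by apply: l01; right|by apply: f'E; right].
    + by apply: piecewiseW fQ; [exact: piecewise_closed gQ'|exact: subsetUr].
    + by apply: continuous_subspaceW lc; exact: subsetUr.
have partial k h : (forall p, Q p -> thick_proj (h p) = thick_proj (f p) /\
    thick_cuts (h p) = thick_cuts (f p) `|` [set l p * cum (w p) j | j in `I_k]) ->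
    piecewise_cellular Q h.
  elim: k h => [|k IHk] h hE.
    apply: eq_piecewise fQ => p /hE[hp hc]; apply: thick_inj => //.
    by rewrite hc II0 image_set0 setU0.
  (* The intermediate refinement is chosen pointwise: the induction hypothesis applies to any
     function with the right base points and cuts. *)
  have /choice[h' h'E] p : exists b, Q p -> thick_proj b = thick_proj (f p) /\
      thick_cuts b = thick_cuts (f p) `|` [set l p * cum (w p) j | j in `I_k].
    have [Qp|nQp] := pselect (Q p); last by exists (f p).
    have [b bE] := partial_join_exists (f p) k (ws _ Qp) (l01 _ Qp).
    by exists b.
  apply: (piecewise_insert (IHk h' h'E) (c := fun p => l p * cum (w p) k)).
  - by apply: continuous_mulf => //; exact: continuous_cum.
  - move=> p Qp; have /andP[? ?] := l01 _ Qp; have /andP[? ?] := cum_itv k (ws _ Qp).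
    by rewrite mulr_ge0//= mulr_ile1.
  - move=> p Qp; have [h'p h'c] := h'E _ Qp; have [-> ->] := hE _ Qp.
    by rewrite h'p h'c -setUA -image_II_recr.
apply: (partial n.+2) => p Qp; have [-> ->] := f'E _ Qp.
by rewrite gE// thick_cutsE ?image_cuts//; exact: ws.
Qed.

End piecewise.
End continuity.

(** * Continuity of the lift *)

Section lift_continuity.
Variables (R : realType) (K : simplicial_set).

Section inside_a_cell.
Variables (n : nat) (z : K n) (t : 'rV[R]_n.+1).
Hypotheses (nd : nondegenerate_cell z) (st : simplex R n t).
Let r := n.+1%:R * min_coord t.
Let xi := thin z t.
Let zeta := boundary_point z t.

Lemma warp_center y : 2^-1 <= r -> 0 <= y <= 1 -> warp xi y = y.
Proof. by move=> r2 y01; have [_ ->//] := flowE nd st; rewrite /step -/r /= r2. Qed.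

Lemma warp_collar y : r <= 2^-1 -> 0 <= y <= 1 ->
  warp xi y = (1 - Num.max 0 (4 * r - 1)) * warp zeta (cut_length t (min_coord t) y / (1 - r)) +
    Num.max 0 (4 * r - 1) * y.
Proof.
move=> r2 y01; have [_ ->//] := flowE nd st; rewrite /step -/r -/zeta /=.
(* At [r = 1/2] the definition uses the central formula; the collar formula agrees, as its weight is
   1. *)
case: leP => // r2'; have -> : Num.max 0 (4 * r - 1) = 1 by rewrite max_r; lra.
by rewrite subrr mul0r add0r mul1r.
Qed.

Lemma row_act_warp : row_act (step z t (warp zeta, thick_lift zeta)).1 t = row_act (warp xi) t.
Proof. by apply: eq_row_act => // y y01; have [_ ->] := flowE nd st. Qed.

Lemma lift_center : 2^-1 <= r -> thick_lift xi = thick z t.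
Proof.
move=> r2; have [-> _] := flowE nd st; rewrite /step -/r -/zeta /=.
case: leP => [r4|_]; first by exfalso; move: r2 r4; lra.
(* At [r = 1/2] the cuts of the boundary lift have shrunk to 0. *)
case: leP => // r2'; have -> : 2 - 4 * r = 0 by lra.
by rewrite join0 r2 (row_act_id (h := id)).
Qed.

Lemma lift_inner_collar : r <= 4^-1 ->
  is_join (thick_lift zeta) (4 * r) (thick z (row_act (warp xi) t)) (thick_lift xi).
Proof.
move=> r4; have r0 : 0 <= r by rewrite mulr_ge0// min_coord_ge0.
have [-> _] := flowE nd st; rewrite -row_act_warp {2}/step -/r -/zeta /= r4.
by apply: joinP; rewrite mulr_ge0//=; lra.
Qed.

(** At [r = 1/4] the definition uses the inner formula. Both scales are then 1 and both points lie
    over the same base point, so the join is symmetric. *)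
Lemma lift_outer_collar : 4^-1 <= r <= 2^-1 ->
  is_join (thick z (row_act (warp xi) t)) (2 - 4 * r) (thick_lift zeta) (thick_lift xi).
Proof.
move=> /andP[r4 r2]; have [r4'|r4'] := leP r 4^-1.
  have J := lift_inner_collar r4'; have [pJ _] := J; move: J.
  have -> : 2 - 4 * r = 1 by lra.
  have -> : 4 * r = 1 by lra.
  apply: is_join_sym; rewrite -pJ; have [wr ->] := warp_spec xi.
  by rewrite thick_proj_thick thin_actE.
have [-> _] := flowE nd st; rewrite -row_act_warp {2}/step -/r -/zeta /= [r <= 4^-1]leNgt r4' /= r2.
by apply: joinP; apply/andP; split; lra.
Qed.

End inside_a_cell.

Lemma closed_argmin (P : topologicalType) (Q : set P) n (g : P -> 'rV[R]_n.+1) i :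
  closed Q -> {within Q, continuous g} ->
  closed (Q `&` [set p | forall j, g p ord0 i <= g p ord0 j]).
Proof.
move=> Qc gc; have -> : Q `&` [set p | forall j, g p ord0 i <= g p ord0 j] =
    \bigcap_j (Q `&` [set p | g p ord0 i <= g p ord0 j]).
  apply/seteqP; split=> [p [Qp gp] j _|p H]; first by split=> //; exact: gp.
  by split=> [|j]; [have [] := H i I|have [] := H j I].
apply: closed_bigI => j _; apply: closed_within_le => //; exact: continuous_coord.
Qed.

(** For the warp, evaluation at every continuous [y] expresses joint continuity without a topology
    on functions. *)
Definition lifts_within n (x : K n) (P : topologicalType) (g : P -> 'rV[R]_n.+1) (A : set P) :=
  piecewise_cellular A (fun p => thick_lift (thin x (g p))) /\
  forall y : P -> R, {within A, continuous y} -> (forall p, A p -> 0 <= y p <= 1) ->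
    {within A, continuous (fun p => warp (thin x (g p)) (y p))}.

(** Arbitrary families are allowed, because the induction hypothesis for a face is applied to the
    boundary points of a family in a larger cell. *)
Definition lifts_continuously n (x : K n) := forall (P : topologicalType)
  (g : P -> 'rV[R]_n.+1) (A : set P), closed A -> {within A, continuous g} ->
  (forall p, A p -> simplex R n (g p)) -> lifts_within x g A.

Lemma within_row_act_warp n (x : K n) (P : topologicalType) (A : set P)
    (g : P -> 'rV[R]_n.+1) :
  (forall y : P -> R, {within A, continuous y} -> (forall p, A p -> 0 <= y p <= 1) ->
    {within A, continuous (fun p => warp (thin x (g p)) (y p))}) ->
  {within A, continuous g} -> (forall p, A p -> simplex R n (g p)) ->
  {within A, continuous (fun p => row_act (warp (thin x (g p))) (g p))}.
Proof.
move=> xw gc gs; apply: continuous_row_cum => j _ /=.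
by apply: xw => [|p Ap]; [exact: continuous_cum|apply: cum_itv; exact: gs].
Qed.

Lemma lifts_withinU n (x : K n) (P : topologicalType) (g : P -> 'rV[R]_n.+1) A B :
  lifts_within x g A -> lifts_within x g B -> lifts_within x g (A `|` B).
Proof.
move=> [Al Aw] [Bl Bw]; split; first exact: Pasting.
move=> y yc y01; apply: withinU_continuous; 
  [exact: piecewise_closed Al|exact: piecewise_closed Bl| |].
- apply: Aw => [|p Ap]; last by apply: y01; left.
  by apply: continuous_subspaceW yc; exact: subsetUl.
- apply: Bw => [|p Bp]; last by apply: y01; right.
  by apply: continuous_subspaceW yc; exact: subsetUr.
Qed.

Lemma lifts_within_center n (z : K n) (P : topologicalType) (g : P -> 'rV[R]_n.+1) A :
  nondegenerate_cell z -> closed A -> {within A, continuous g} ->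
  (forall p, A p -> simplex R n (g p)) ->
  (forall p, A p -> 2^-1 <= n.+1%:R * min_coord (g p)) -> lifts_within z g A.
Proof.
move=> nd Ac gc gs Ar; split.
  apply: (@Cellular _ _ _ _ _ _ z g) => // p Ap.
  by apply: lift_center => //; [exact: gs|exact: Ar].
move=> y yc y01; apply: (@subspace_eq_continuous _ A _ y) => // p /set_mem Ap.
by apply/esym/warp_center => //; [exact: gs|exact: Ar|exact: y01].
Qed.

(** On [A] the i-th coordinate is least, so the boundary points [b] stay in the face [i], to which
    the induction hypothesis applies. The lift is then a join of piecewise cellular maps on either
    half of the collar. *)
Lemma lifts_within_collar n (z : K n.+1) (P : topologicalType) (g : P -> 'rV[R]_n.+2) A i :
  nondegenerate_cell z -> (forall x : K n, lifts_continuously x) ->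
  closed A -> {within A, continuous g} -> (forall p, A p -> simplex R n.+1 (g p)) ->
  (forall p, A p -> forall j, g p ord0 i <= g p ord0 j) ->
  (forall p, A p -> n.+2%:R * g p ord0 i <= 2^-1) -> lifts_within z g A.
Proof.
move=> nd IH Ac gc gs gi Ar.
pose m p := g p ord0 i; pose r p := n.+2%:R * m p.
have mE p : A p -> min_coord (g p) = m p by move=> Ap; apply: min_coordE; exact: gi.
have mc : {within A, continuous m} by exact: continuous_coord.
have rc : {within A, continuous r} by apply: continuous_mulf => //; exact: cst_continuous.
have m0 p : A p -> 0 <= m p by move=> /gs[+ _]; exact.
have r0 p : A p -> 0 <= r p by move=> Ap; rewrite mulr_ge0// m0.
have r1 p : A p -> r p < 1 by move=> Ap; apply: le_lt_trans (Ar _ Ap) _; lra.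
(* The maximum keeps the denominator away from 0 off [A], where nothing is known about [r]; on [A]
   it equals [1 - r p]. *)
pose d p := (Num.max 2^-1 (1 - r p))^-1.
have dc : {within A, continuous d}.
  apply: continuous_invf; last by move=> p; rewrite gt_eqF// lt_max; apply/orP; left; lra.
  apply: continuous_maxf; first exact: cst_continuous.
  by apply: continuous_subf => //; exact: cst_continuous.
have dE p : A p -> d p = (1 - r p)^-1.
  by move=> Ap; rewrite /d max_r//; have := Ar _ Ap; rewrite -/(m p) -/(r p); lra.
have bs p : A p -> simplex R n.+1 (squeeze (g p) (m p)).
  by move=> Ap; apply: simplex_squeeze; [exact: gs|exact: gi|exact: r1].
have bi p : squeeze (g p) (m p) ord0 i = 0 by rewrite mxE subrr mul0r.
pose b p := face_row i (squeeze (g p) (m p)).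
have bc : {within A, continuous b}.
  apply: continuous_face_row; apply: (@subspace_eq_continuous _ A _
    (fun p => \row_j ((g p ord0 j - m p) * d p))).
    by move=> p /set_mem Ap; apply/rowP => j; rewrite !mxE dE.
  apply: continuous_row => j; under eq_fun do rewrite mxE.
  apply: continuous_mulf => //; apply: continuous_subf => //.
  exact: continuous_coord.
have b_simplex p : A p -> simplex R n (b p).
  by move=> Ap; apply: simplex_face_row => //; exact: bs.
have bdE p : A p -> boundary_point z (g p) = thin (cell_map (coface i) z) (b p).
  by move=> Ap; rewrite /boundary_point mE// (boundary_face z (bs _ Ap) (bi p)).
have IHb B : closed B -> B `<=` A -> lifts_within (cell_map (coface i) z) b B.
  move=> Bc BA; apply: IH => //; first exact: continuous_subspaceW bc.
  by move=> p /BA; exact: b_simplex.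
have wc : forall y : P -> R, {within A, continuous y} -> (forall p, A p -> 0 <= y p <= 1) ->
    {within A, continuous (fun p => warp (thin z (g p)) (y p))}.
  move=> y yc y01; pose a p := Num.max 0 (4 * r p - 1).
  have ac : {within A, continuous a}.
    apply: continuous_maxf; first exact: cst_continuous.
    apply: continuous_subf; last exact: cst_continuous.
    by apply: continuous_mulf => //; exact: cst_continuous.
  pose y' p := cut_length (g p) (m p) (y p) * d p.
  apply: (@subspace_eq_continuous _ A _ (fun p =>
      (1 - a p) * warp (thin (cell_map (coface i) z) (b p)) (y' p) + a p * y p)).
    move=> p /set_mem Ap; rewrite -bdE// /y' dE//; apply/esym.
    have := @warp_collar _ z (g p) nd (gs _ Ap) (y p).
    by rewrite !mE//; apply; [exact: Ar|exact: y01].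
  have [_ bw] := IHb A Ac (@subset_refl _ A).
  apply: continuous_addf; last exact: continuous_mulf.
  apply: continuous_mulf; first by apply: continuous_subf => //; exact: cst_continuous.
  apply: bw; first by apply: continuous_mulf => //; exact: continuous_cut_length.
  move=> p Ap; rewrite /y' dE//.
  by apply: stretch_itv; [exact: gs|exact: m0|exact: gi|exact: r1|exact: y01].
split=> //.
have zc B : closed B -> B `<=` A ->
    piecewise_cellular B (fun p => thick z (row_act (warp (thin z (g p))) (g p))).
  move=> Bc BA; apply: (@Cellular _ _ _ _ _ _ z
    (fun p => row_act (warp (thin z (g p))) (g p))) => //.
    by apply: continuous_subspaceW BA _; exact: within_row_act_warp.
  by move=> p Bp; apply: simplex_row_act; [exact: (warp_spec _).1|exact: gs (BA _ Bp)].
have cstc (c : R) : {within A, continuous (fun=> c)} by exact: cst_continuous.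
have c4 : {within A, continuous (fun p => 4 * r p)} by exact: continuous_mulf (cstc 4) rc.
have A1c := closed_within_le Ac rc (cstc 4^-1).
have A2c := closed_within_le Ac (cstc 4^-1) rc.
have -> : A = (A `&` [set p | r p <= 4^-1]) `|` (A `&` [set p | 4^-1 <= r p]).
  rewrite -setIUr; apply/esym/setIidl => p _ /=.
  by case: (leP (r p) 4^-1) => [|/ltW]; [left|right].
apply: Pasting.
- have A1A : A `&` [set p | r p <= 4^-1] `<=` A by exact: subIsetl.
  apply: (piecewise_join (IHb _ A1c A1A).1 (zc _ A1c A1A) (l := fun p => 4 * r p)).
  + exact: continuous_subspaceW c4.
  + by move=> p [/r0 rp0 /= rp]; rewrite mulr_ge0//=; lra.
  + move=> p [Ap rp]; rewrite -bdE//.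
    by have := @lift_inner_collar _ z (g p) nd (gs _ Ap); rewrite mE//; exact.
- have A2A : A `&` [set p | 4^-1 <= r p] `<=` A by exact: subIsetl.
  apply: (piecewise_join (zc _ A2c A2A) (IHb _ A2c A2A).1 (l := fun p => 2 - 4 * r p)).
  + by apply: continuous_subspaceW A2A _; exact: continuous_subf (cstc 2) c4.
  + by move=> p [/Ar rp2 /= rp]; rewrite -/(m p) -/(r p) in rp2; apply/andP; split; lra.
  + move=> p [Ap rp]; rewrite -bdE//.
    have := @lift_outer_collar _ z (g p) nd (gs _ Ap); rewrite mE//; apply.
    by apply/andP; split=> //; exact: Ar.
Qed.

(** Induction on the dimension. A degenerate cell reduces to a smaller one; for a nondegenerate
    cell, [A] is divided according to the least coordinate, then into collar and centre. *)
Lemma lifts_continuously_all n (x : K n) : lifts_continuously x.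
Proof.
elim/ltn_ind: n x => n IH x P g A Ac gc gs.
have [nd|[m [y [f [mn xE]]]]] := nondegenerate_or_degenerate x; last first.
  have [yl yw] := @IH m mn y P (fun p => push_row f (g p)) A Ac
    (continuous_push_row gc) (fun p Ap => push_row_simplex f (gs p Ap)).
  split; first by apply: eq_piecewise yl => p Ap; rewrite xE thin_glue//; exact: gs.
  move=> v vc v01; apply: subspace_eq_continuous (yw v vc v01) => p /set_mem Ap.
  by congr (warp _ _); rewrite xE thin_glue//; exact: gs.
case: n x g gc gs nd IH => [|n] x g gc gs nd IH.
  apply: lifts_within_center => // p Ap.
  (* In dimension 0 the only coordinate is 1, so every point is central. *)
  suff -> : min_coord (g p) = 1 by lra.
  by have [_ <-] := gs _ Ap; rewrite big_ord1; apply: min_coordE => j; rewrite (ord1 j).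
have cover : A = \bigcup_i (A `&` [set p | forall j, g p ord0 i <= g p ord0 j]).
  apply/seteqP; split=> [p Ap|p [i _ []//]].
  have [i gi] := min_coord_attained (g p); exists i => //; split=> // j.
  by rewrite -gi min_coord_le.
rewrite cover; apply: (@finite_cover_ind P (lifts_within x g) n.+1
  (fun i => A `&` [set p | forall j, g p ord0 i <= g p ord0 j])).
  by move=> B B'; exact: lifts_withinU.
move=> i; set B := A `&` _.
have Bc : closed B by exact: closed_argmin.
have BA : B `<=` A by exact: subIsetl.
have gBc := continuous_subspaceW BA gc.
pose r p := n.+2%:R * g p ord0 i.
have rc : {within B, continuous r}.
  by apply: continuous_mulf; [exact: cst_continuous|exact: continuous_coord].
have cstc : {within B, continuous (fun=> 2^-1 : R)} by exact: cst_continuous.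
have -> : B = (B `&` [set p | r p <= 2^-1]) `|` (B `&` [set p | 2^-1 <= r p]).
  rewrite -setIUr; apply/esym/setIidl => p _ /=.
  by case: (leP (r p) 2^-1) => [|/ltW]; [left|right].
apply: lifts_withinU.
- apply: (@lifts_within_collar _ _ _ _ _ i) => //.
  + by move=> y; exact: IH.
  + exact: closed_within_le.
  + by apply: continuous_subspaceW gBc; exact: subIsetl.
  + by move=> p [/BA/gs].
  + by move=> p [[]].
  + by move=> p [].
- apply: lifts_within_center => //.
  + exact: closed_within_le.
  + by apply: continuous_subspaceW gBc; exact: subIsetl.
  + by move=> p [/BA/gs].
  + by move=> p [[Ap gi] rp]; rewrite (min_coordE gi).
Qed.

End lift_continuity.

(** * Maps out of coends *)

Section coend_topology.
Variables (R : realType) (K : simplicial_set).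
Variable S : forall m n, delta_hom m n -> Prop.

Lemma continuous_coend (Y : topologicalType) (f : coend R K S -> Y) :
  (forall n (x : K n),
    continuous (fun t : simplex R n => f (\pi_(coend R K S) (cell_point x t)))) ->
  continuous f.
Proof.
move=> fc; apply/quotient_continuous => -[n [x t]] A /fc fA.
(* The cells being discrete, a neighbourhood within the simplex of [x] is one in the coproduct. *)
exists ([set x], (fun t => f (\pi_(coend R K S) (cell_point x t))) @^-1` A).
  by split.
by move=> [y u] [/= -> Au].
Qed.

Lemma compact_unit_interval : compact [set: unit_interval R].
Proof.
move=> F FF _.
have [|y [y01 yF]] := @segment_compact R 0 1 (set_val @ F) _.
  apply: (@filterS _ F _ setT) (filterT) => p _; exact: set_mem (valP p).
exists (SigSub (mem_set y01)); split=> // A B FA [_ [[U oU <-] /= yU UB]].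
have [||_ [[p Ap <-] Up]] := yF (set_val @` A) U.
- by apply: (@filterS _ F _ A) FA => p Ap; exists p.
- exact: open_nbhs_nbhs.
by exists p; split=> //; exact: UB.
Qed.

Import ArrowAsCompactOpen.

(** A product of quotient maps with the interval is handled by currying: continuity into the
    compact-open function space is tested on cells, and uncurrying is possible because the interval
    is compact and regular. *)
Lemma continuous_coend_interval (Y : topologicalType) (H : coend R K S * unit_interval R -> Y) :
  (forall n (x : K n), continuous (fun q : simplex R n * unit_interval R =>
    H (\pi_(coend R K S) (cell_point x q.1), q.2))) ->
  continuous H.
Proof.
move=> Hc; have Hcurry n (x : K n) := continuous_curry (Hc n x).
rewrite -[H]curryK; apply: continuous_uncurry_regular.
- move=> s _; exists setT; first exact: filterT.
  by split; [exact: compact_unit_interval|exact: closedT].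
- exact: uniform_regular.
- by apply: continuous_coend => n x; have [] := Hcurry n x.
- elim/quotW => -[n [x t]]; have [_ /(_ t)] := Hcurry n x.
  exact.
Qed.

End coend_topology.

(** * The homotopies *)

Section homotopy_inverse.
Variables (R : realType) (K : simplicial_set).

Definition mix (a : R) (h : R -> R) (y : R) : R := (1 - a) * h y + a * y.

Lemma mix0 h : mix 0 h = h.
Proof. by apply/funext => y; rewrite /mix subr0 mul1r mul0r addr0. Qed.

Lemma mix1 h : mix 1 h = id.
Proof. by apply/funext => y; rewrite /mix subrr mul0r add0r mul1r. Qed.

Lemma reparametrisation_mix a h : 0 <= a <= 1 -> reparametrisation h ->
  reparametrisation (mix a h).
Proof.
move=> /andP[a0 a1] [h0 h1 hle]; rewrite /mix; split=> [||x y x0 xy y1].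
- by rewrite h0 !mulr0 addr0.
- by rewrite h1 !mulr1 subrK.
- by rewrite lerD// ler_wpM2l ?subr_ge0// hle.
Qed.

Lemma thin_act_id (xi : realisation R K) : thin_act id xi = xi.
Proof. by have [n [x [t [st ->]]]] := thinP xi; rewrite thin_actE ?(row_act_id (h := id)). Qed.

Lemma thick_act_id (a : thick_realisation R K) : thick_act id a = a.
Proof. by have [n [x [t [st ->]]]] := thickP a; rewrite thick_actE ?(row_act_id (h := id)). Qed.

Lemma pi_thin n (x : K n) (t : simplex R n) :
  \pi_(coend R K in_Delta) (cell_point x t) = thin x (\val t).
Proof. by rewrite /thin to_simplex_val. Qed.

Lemma pi_thick n (x : K n) (t : simplex R n) :
  \pi_(coend R K in_Upsilon) (cell_point x t) = thick x (\val t).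
Proof. by rewrite /thick to_simplex_val. Qed.

Lemma continuous_val_simplex n : continuous (fun t : simplex R n => \val t).
Proof. exact: initial_continuous. Qed.

Lemma continuous_thick_proj : continuous (@thick_proj R K).
Proof.
apply: continuous_coend => n x.
rewrite (_ : (fun t => _) = (fun t => thin x (\val t))); last first.
  by apply/funext => t; rewrite pi_thick thick_proj_thick.
apply/continuous_subspace_setT; apply: continuous_thin_within.
  by apply: continuous_subspaceT; exact: continuous_val_simplex.
by move=> t _; exact: val_simplex.
Qed.

Lemma continuous_thick_lift : continuous (@thick_lift R K).
Proof.
apply: continuous_coend => n x.
rewrite (_ : (fun t => _) = (fun t => thick_lift (thin x (\val t)))); last first.
  by apply/funext => t; rewrite pi_thin.
apply/continuous_subspace_setT; apply: piecewise_continuous.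
(* The family is the universal one, the inclusion of the simplex into the rows. *)
have [|||//] := @lifts_continuously_all R K n x _ (fun t : simplex R n => \val t) setT.
- exact: closedT.
- by apply: continuous_subspaceT; exact: continuous_val_simplex.
- by move=> t _; exact: val_simplex.
Qed.

Section cylinder.
Variables (n : nat) (x : K n).
Local Notation cylinder := (simplex R n * unit_interval R)%type.

Lemma continuous_cylinder_fst : continuous (fun q : cylinder => \val q.1).
Proof.
by move=> q; apply: continuous_comp; [exact: cvg_fst|exact: continuous_val_simplex].
Qed.

Lemma continuous_cylinder_snd : continuous (fun q : cylinder => \val q.2 : R).
Proof.
by move=> q; apply: continuous_comp; [exact: cvg_snd|exact: initial_continuous].
Qed.

Lemma unit_interval_itv (u : unit_interval R) : 0 <= (\val u : R) <= 1.
Proof. by have := set_mem (valP u); rewrite /unit_interval /= in_itv. Qed.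

Lemma cylinder_lifts (A : set cylinder) : closed A ->
  lifts_within x (fun q : cylinder => \val q.1) A.
Proof.
move=> Ac; apply: lifts_continuously_all => //.
  by apply: continuous_subspaceT; exact: continuous_cylinder_fst.
by move=> q _; exact: val_simplex.
Qed.

Lemma within_row_act_mix (A : set cylinder) (a : cylinder -> R) : closed A ->
  {within A, continuous a} ->
  {within A, continuous (fun q : cylinder =>
    row_act (mix (a q) (warp (thin x (\val q.1)))) (\val q.1))}.
Proof.
move=> Ac ac; have vc : {within A, continuous (fun q : cylinder => \val q.1)}.
  by apply: continuous_subspaceT; exact: continuous_cylinder_fst.
apply: continuous_row_cum => j _; apply: continuous_addf; apply: continuous_mulf => //.
- by apply: continuous_subf => //; exact: cst_continuous.
- apply: (cylinder_lifts Ac).2; first exact: continuous_cum.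
  by move=> q _; apply: cum_itv; exact: val_simplex.
- exact: continuous_cum.
Qed.

End cylinder.

(** By [warp_spec] the composite moves each point by its warp, which is deformed linearly to the
    identity. *)
Lemma homotopic_proj_lift : homotopic R (@thick_proj R K \o @thick_lift R K) id.
Proof.
exists (fun q => thin_act (mix (\val q.2 : R) (warp q.1)) q.1); split.
- apply: continuous_coend_interval => n x.
  pose H (q : simplex R n * unit_interval R) :=
    thin x (row_act (mix (\val q.2 : R) (warp (thin x (\val q.1)))) (\val q.1)).
  rewrite (_ : (fun q => _) = H); last first.
    apply/funext => q; rewrite /= pi_thin thin_actE//; last exact: val_simplex.
    by apply: reparametrisation_mix; [exact: unit_interval_itv|exact: (warp_spec _).1].
  apply/continuous_subspace_setT; apply: continuous_thin_within.
    apply: within_row_act_mix; first exact: closedT.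
    by apply: continuous_subspaceT; exact: continuous_cylinder_snd.
  move=> q _; apply: simplex_row_act; last exact: val_simplex.
  by apply: reparametrisation_mix; [exact: unit_interval_itv|exact: (warp_spec _).1].
- by move=> xi s s0 /=; rewrite s0 mix0; have [_ ->] := warp_spec xi.
- by move=> xi s s1 /=; rewrite s1 mix1 thin_act_id.
Qed.

(* In reversed time: move [a] along [warp], refine it by the cuts of the lift, then shrink
   the cuts of [a] into 0. *)
Definition lift_homotopy (q : thick_realisation R K * unit_interval R) :
    thick_realisation R K :=
  let xi := thick_proj q.1 in
  let u : R := \val q.2 in
  if u <= 3^-1 then join (thick_lift xi) (3 * u) (thick_act (warp xi) q.1)
  else join (thick_act (mix (Num.max 0 (3 * u - 2)) (warp xi)) q.1)
         (Num.max 0 (2 - 3 * u)) (thick_lift xi).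

Lemma homotopic_lift_proj : homotopic R (@thick_lift R K \o @thick_proj R K) id.
Proof.
exists lift_homotopy; split; last first.
- move=> a s s1; rewrite /lift_homotopy /= s1.
  have -> : ((1 : R) <= 3^-1) = false by lra.
  have -> : Num.max 0 (3 * 1 - 2) = 1 :> R by rewrite max_r; lra.
  have -> : Num.max 0 (2 - 3 * 1) = 0 :> R by rewrite max_l; lra.
  by rewrite mix1 thick_act_id join0.
- move=> a s s0; rewrite /lift_homotopy /= s0 mulr0 join0.
  by have -> : ((0 : R) <= 3^-1) = true by lra.
apply: continuous_coend_interval => n x.
pose g (q : simplex R n * unit_interval R) : 'rV[R]_n.+1 := \val q.1.
pose u (q : simplex R n * unit_interval R) : R := \val q.2.
have uc : continuous u by exact: continuous_cylinder_snd.
have u01 q : 0 <= u q <= 1 by exact: unit_interval_itv.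
have gs q : simplex R n (g q) by exact: val_simplex.
pose H q := lift_homotopy (thick x (g q), q.2).
rewrite (_ : (fun q => _) = H); last by apply/funext => q; rewrite /H /= pi_thick.
have cstc (c : R) : continuous (fun _ : simplex R n * unit_interval R => c).
  exact: cst_continuous.
pose A := [set q | u q <= 3^-1]; pose B := [set q | 3^-1 <= u q].
have Ac : closed A.
  by rewrite -[A]setTI; apply: closed_within_le; [exact: closedT|exact: continuous_subspaceT..].
have Bc : closed B.
  by rewrite -[B]setTI; apply: closed_within_le; [exact: closedT|exact: continuous_subspaceT..].
have wr q : reparametrisation (warp (thin x (g q))) by exact: (warp_spec _).1.
have actE (a : R) q : 0 <= a <= 1 ->
    thick_act (mix a (warp (thin x (g q)))) (thick x (g q)) =
    thick x (row_act (mix a (warp (thin x (g q)))) (g q)).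
  by move=> a01; rewrite thick_actE//; exact: reparametrisation_mix.
have mixed (Q : set (simplex R n * unit_interval R)) (a : _ -> R) : closed Q -> continuous a ->
    (forall q, 0 <= a q <= 1) -> piecewise_cellular Q (fun q =>
      thick_act (mix (a q) (warp (thin x (g q)))) (thick x (g q))).
  move=> Qc ac a01; apply: (@Cellular _ _ _ _ _ _ x (fun q =>
      row_act (mix (a q) (warp (thin x (g q)))) (g q))) => //.
  - by apply: within_row_act_mix => //; exact: continuous_subspaceT.
  - by move=> q _; apply: simplex_row_act => //; exact: reparametrisation_mix.
  - by move=> q _; exact: actE.
apply/continuous_subspace_setT; have -> : setT = A `|` B.
  apply/seteqP; split=> // q qT.
  by have [uq|/ltW uq] := leP (u q) 3^-1; [left|right].
apply: piecewise_continuous; apply: Pasting.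
- have zero01 := conj (lexx (0 : R)) (@ler01 R).
  have := mixed A (fun=> 0) Ac (cstc 0) (fun=> introT andP zero01).
  move=> /(piecewise_join (cylinder_lifts x Ac).1 (l := fun q => 3 * u q)); apply.
  + by apply: continuous_subspaceT; exact: continuous_mulf (cstc 3) uc.
  + move=> q Aq; have {}Aq : u q <= 3^-1 := Aq; have /andP[u0 _] := u01 q.
    by rewrite mulr_ge0//=; lra.
  + move=> q Aq; have {Aq} uq : u q <= 3^-1 := Aq.
    rewrite mix0 /H /lift_homotopy /= -/(u q) uq thick_proj_thick.
    by apply: joinP; have /andP[u0 _] := u01 q; rewrite mulr_ge0//=; lra.
(* For [u] from 1/3 to 2/3 only [l] changes, from 1 to 0; afterwards only [a] does, from 0 to 1. *)
- pose a q := Num.max 0 (3 * u q - 2); pose l q := Num.max 0 (2 - 3 * u q).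
  have c3 : continuous (fun q => 3 * u q) by exact: continuous_mulf (cstc 3) uc.
  have ac : continuous a.
    by apply: continuous_maxf (cstc 0) _; exact: continuous_subf c3 (cstc 2).
  have lc : continuous l.
    by apply: continuous_maxf (cstc 0) _; exact: continuous_subf (cstc 2) c3.
  have a01 q : 0 <= a q <= 1.
    by have /andP[_ u1] := u01 q; rewrite le_max lexx/= ge_max ler01/=; lra.
  have l01 q : B q -> 0 <= l q <= 1.
    by move=> Bq; have {}Bq : 3^-1 <= u q := Bq; rewrite le_max lexx/= ge_max ler01/=; lra.
  apply: (piecewise_join (mixed B a Bc ac a01) (cylinder_lifts x Bc).1 (l := l)) => //.
    exact: continuous_subspaceT.
  move=> q Bq; rewrite /H /lift_homotopy /= -/(u q) -/(a q) -/(l q) thick_proj_thick.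
  case: leP => [uq|_]; last by apply: joinP; exact: l01.
  (* At [u = 1/3] the first formula is in force; it agrees with the second because both joins are
     unscaled and, by [warp_spec], over the same point. *)
  have uE : u q = 3^-1 by apply/eqP; rewrite eq_le uq; exact: Bq.
  have -> : l q = 1 by rewrite /l uE max_r; lra.
  have -> : a q = 0 by rewrite /a uE max_l; lra.
  have -> : 3 * u q = 1 by rewrite uE; lra.
  rewrite mix0; apply: is_join_sym; last by apply: joinP; rewrite ler01 lexx.
  by have [_ ->] := warp_spec (thin x (g q)); rewrite thick_proj_act// thick_proj_thick.
Qed.

End homotopy_inverse.

Theorem corollary1p3 (R : realType) (K : simplicial_set) :
  homotopy_equivalence R (@thick_proj R K).
Proof.
split; first exact: continuous_thick_proj.
exists (@thick_lift R K); split.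
- exact: continuous_thick_lift.
- exact: homotopic_lift_proj.
- exact: homotopic_proj_lift.
Qed.
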